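(* Let $d\ge 2$ be an integer, $\sigma^2>0$ and $0<r\le R$. There exist positive constants $c_0,c_1,c_2,c_3$, depending only on $d,r,R,\sigma^2$, such that the following holds. Let $n>3$ be an integer, $b_n=\sqrt{2\sigma^2\ln n}$, and let $M$ be a positive integer with $(\ln M)/b_n\le\min(r/(4\sigma^2),1/2)$. Then for every convex body $G\subseteq\mathbb{R}^d$ such that $B_d(a,r)\subseteq G\subseteq B_d(0,R)$ for some $a\in\mathbb{R}^d$, and for all positive $x$ with $x\le\frac{rb_n}{4\sigma^2}-\ln M$, $$\mathsf{d}_{\mathsf H}(\hat G_M,G)\le c_0\,\frac{x+\ln M}{b_n}$$ with probability at least $$1-c_1e^{-x}-Me^{-c_2n}-(6b_n)^d e^{-c_3M(\ln M)^{d-1}b_n^{-(d-1)}}.$$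
   Context: A convex body is a convex compact subset of $\mathbb{R}^d$ with nonempty interior; $B_d(a,\rho)$ is the Euclidean ball with center $a$ and radius $\rho$; $\mathbb{S}^{d-1}$ is the unit sphere of $\mathbb{R}^d$. Model: $Y_j=X_j+\varepsilon_j$, $j=1,\ldots,n$, where $X_1,\ldots,X_n$ are i.i.d. uniform in the convex body $G$ and $\varepsilon_1,\ldots,\varepsilon_n$ are i.i.d. $d$-dimensional centered Gaussian vectors with covariance matrix $\sigma^2I$, independent of the $X_j$'s; $\sigma^2$ is known. Estimator: for $u\in\mathbb{R}^d$, $\hat h(u)=\max_{1\le j\le n}\langle u,Y_j\rangle-b_n$. Let $U_1,\ldots,U_M$ be independent uniform random vectors on $\mathbb{S}^{d-1}$, independent of the data $Y_1,\ldots,Y_n$, and $$\hat G_M=\{x\in\mathbb{R}^d:\langle U_j,x\rangle\le\hat h(U_j),\ \forall j=1,\ldots,M\}.$$ The probability is with respect to the joint law of the data and the $U_j$'s. The Hausdorff distance is $\mathsf{d}_{\mathsf H}(A,B)=\inf\{\epsilon>0: A\subseteq B+\epsilon B_d(0,1)\text{ and }B\subseteq A+\epsilon B_d(0,1)\}$, with $\inf\emptyset=+\infty$. *)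

(* Defs.v *)
From HB Require Import structures.
From mathcomp Require Import all_boot all_order all_algebra.
From mathcomp Require Import all_classical all_reals all_analysis.

Set Implicit Arguments.
Unset Strict Implicit.
Unset Printing Implicit Defensive.

Import Order.TTheory GRing.Theory Num.Theory.
Import numFieldNormedType.Exports.

Local Open Scope classical_set_scope.
Local Open Scope ring_scope.

(* R^d as a measurable space: row vectors with the Borel sigma-algebra.  It is
   convertible to 'rV[R]_d. *)
Notation Rvec R d := (g_sigma_algebraType (@open 'rV[R]_d)).

Section euclidean.
Context {R : realType} {d : nat}.
Implicit Types (u v a b x : 'rV[R]_d) (A B : set 'rV[R]_d).

Definition dot u v : R := \sum_(i < d) u 0 i * v 0 i.

(* The library norm of 'rV[R]_d is the sup norm, hence this one. *)
Definition enorm u : R := Num.sqrt (dot u u).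

Definition eball a (rho : R) : set 'rV[R]_d := [set x | enorm (x - a) <= rho].

Definition esphere : set 'rV[R]_d := [set x | enorm x = 1].

Definition convex_body A := [/\ convex_set A, compact A & A° !=set0].

Definition parallel_set A (e : R) : set 'rV[R]_d :=
  [set a + e *: v | a in A & v in eball 0 1].

Definition hausdorff_dist A B : \bar R :=
  ereal_inf [set e%:E | e in [set e : R |
    [/\ 0 < e, A `<=` parallel_set B e & B `<=` parallel_set A e]]].

Definition box a b : set 'rV[R]_d :=
  [set x | forall i, a 0 i <= x 0 i <= b 0 i].

Definition box_volume (a b : 'rV[R]_d) : R := \prod_(i < d) (b 0 i - a 0 i).

(* Lebesgue outer measure, the infimum of the total volumes of the countable
   covers by closed boxes; only its values on Borel sets are used below, where
   it is the d-dimensional Lebesgue measure. *)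
Definition lebesgue_vec A : \bar R :=
  ereal_inf [set (\sum_(0 <= k <oo) (box_volume (c k).1 (c k).2)%:E)%E
    | c in [set c : nat -> 'rV[R]_d * 'rV[R]_d |
        (forall k i, (c k).1 0 i <= (c k).2 0 i) /\
        A `<=` \bigcup_k box (c k).1 (c k).2]].

End euclidean.

Section laws.
Context {R : realType} {d : nat} {dT : measure_display} {T : measurableType dT}
  (P : probability T R).
Implicit Types Z : {RV P >-> Rvec R d}.

Definition uniform_on_body Z (G : set 'rV[R]_d) :=
  forall A : set (Rvec R d), measurable A ->
    distribution P Z A =
    (fine (lebesgue_vec (A `&` G)) / fine (lebesgue_vec G))%:E.

(* N(m, v) with variance v; normal_prob takes the standard deviation and is not
   a Dirac measure when the latter is 0. *)
Definition normal_law (m v : R) (A : set R) : \bar R :=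
  if v == 0 then dirac m A else normal_prob m (Num.sqrt v) A.

(* Z is Gaussian with mean m and covariance matrix C: every linear functional
   <u, Z> has the law N(<u, m>, u C u^T). *)
Definition gaussian_vector Z (m : 'rV[R]_d) (C : 'M[R]_d) :=
  forall (u : 'rV[R]_d) (A : set R), measurable A ->
    P [set w | A (dot u (Z w))] =
    normal_law (dot u m) ((u *m C *m u^T) 0 0) A.

(* The uniform law on the unit sphere is the only probability measure carried
   by the sphere that is invariant under the orthogonal group. *)
Definition uniform_on_sphere Z :=
  distribution P Z (@esphere R d) = 1%E /\
  forall Q : 'M[R]_d, Q *m Q^T = 1%:M ->
  forall A : set (Rvec R d), measurable A ->
    P [set w | A ((Z w : 'rV[R]_d) *m Q)] = distribution P Z A.

End laws.

Section independence.
Context {R : realType} {dT dS : measure_display} {T : measurableType dT}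
  {S : measurableType dS} (P : probability T R).

Definition mutually_independent (I : finType) (Z : I -> T -> S) :=
  forall (J : {set I}) (A : I -> set S), (forall i, measurable (A i)) ->
    P [set w | forall i, i \in J -> A i (Z i w)] =
    (\prod_(i in J) P (Z i @^-1` A i))%E.

(* Independence of the sigma-algebras generated by two finite families. *)
Definition independent_families (m n : nat) (Y : 'I_m -> T -> S)
    (Z : 'I_n -> T -> S) :=
  forall A B : set T, g_sigma_preimage Y A -> g_sigma_preimage Z B ->
    P (A `&` B) = (P A * P B)%E.

End independence.

Section estimator.
Context {R : realType} {d : nat}.

Definition b_ (sigma : R) (n : nat) : R :=
  Num.sqrt (2 * sigma ^+ 2 * ln n%:R).

(* For n > 0 the supremum is a maximum of n real numbers. *)
Definition h_hat (sigma : R) (n : nat) (y : 'I_n -> 'rV[R]_d)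
    (u : 'rV[R]_d) : R :=
  sup [set dot u (y j) | j in [set: 'I_n]] - b_ sigma n.

Definition G_hat (sigma : R) (n M : nat) (y : 'I_n -> 'rV[R]_d)
    (u : 'I_M -> 'rV[R]_d) : set 'rV[R]_d :=
  [set x | forall j, dot (u j) x <= h_hat sigma y (u j)].

End estimator.

(* Main.v *)
Require Import Defs.
From HB Require Import structures.
From mathcomp Require Import all_boot all_order all_algebra.
From mathcomp Require Import all_classical all_reals all_analysis.
From mathcomp Require Import measurable_realfun.
From mathcomp Require Import ring lra.

Set Implicit Arguments.
Unset Strict Implicit.
Unset Printing Implicit Defensive.

Import Order.TTheory GRing.Theory Num.Theory.
Import numFieldNormedType.Exports.

Local Open Scope classical_set_scope.
Local Open Scope ring_scope.

(** The error of the polytope is controlled by three events.  Let [h] be the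
    support function of the body and [tau = (x + ln M) / b].

    Fix a unit vector [u].  No noise term exceeds [b + sigma ^+ 2 * tau] in the
    direction [u], except with probability [expR (- x) / M]: the normalisation
    [b] is chosen so that the Gaussian tail at [b] is [1 / n], and moving the
    level up by [s] multiplies the tail by at most
    [expR (- b * s / sigma ^+ 2)] ([upper_deviation]).  Conversely, the body
    contracted by [1 / b] towards a support point lies in a cap of height of
    order [1 / b], so that this cap has probability at least [b ^- d]
    ([uniform_on_body_cap]); together with a lower bound on the Gaussian density
    at [b - t], the expected number of observations above [h u + b - t] is at
    least of order [b ^- d.+1 * expR (b * t / sigma ^+ 2)]
    ([lower_deviation]).  This exceeds [x + ln M] for [t] a large multiple of
    [tau], but only when [ln M] dominates [ln b].  That is where the last error
    term of the theorem enters: when it is less than [1], [M] is at least a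
    power of [b] ([many_directions]), and otherwise the claimed lower bound on
    the probability is nonpositive.  Since [t] must stay below the inradius [r],
    it is capped at [r / 2]; there the exponential factor wins by itself,
    because [x + ln M] is at most [r * b / (4 * sigma ^+ 2)].

    These bounds hold for fixed directions, and the directions [U k] are random
    but independent of the observations.  They are transferred by replacing
    [U k] by a nearby point of a very fine deterministic net; the cells of the
    net are handled one at a time, and independence is used for each cell
    ([independent_cells], [random_direction_estimates]).

    Finally the directions form a [ln M / b]-net of the sphere.  By rotation
    invariance all balls of a given radius centred on the sphere have the same
    probability, and a grid on the faces of a cube yields a cover of the sphere
    by [N] of them with [N] of order [delta ^- d.-1] ([sphere_net]), so each has
    probability at least [1 / N] and all are hit except with probability
    [N * expR (- M / N)] ([uniform_directions_net]).

    On these events the theorem is a statement about one polytope whose facets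
    have nearly the right normals and heights ([hausdorff_polytope_le]). *)

(** * Euclidean geometry of row vectors *)

Section euclidean_lemmas.
Context {R : realType} {d : nat}.
Implicit Types (u v w a b x y : 'rV[R]_d) (A B : set 'rV[R]_d).

Lemma dotC u v : dot u v = dot v u.
Proof. by apply: eq_bigr => i _; rewrite mulrC. Qed.

Lemma dotDl u v w : dot (u + v) w = dot u w + dot v w.
Proof. by rewrite -big_split; apply: eq_bigr => i _; rewrite mxE mulrDl. Qed.

Lemma dotZl (k : R) u v : dot (k *: u) v = k * dot u v.
Proof. by rewrite mulr_sumr; apply: eq_bigr => i _; rewrite mxE mulrA. Qed.

Lemma dotDr u v w : dot w (u + v) = dot w u + dot w v.
Proof. by rewrite dotC dotDl !(dotC w). Qed.

Lemma dotZr (k : R) u v : dot u (k *: v) = k * dot u v.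
Proof. by rewrite dotC dotZl (dotC u). Qed.

Lemma dotNl u v : dot (- u) v = - dot u v.
Proof. by rewrite -scaleN1r dotZl mulN1r. Qed.

Lemma dotNr u v : dot u (- v) = - dot u v.
Proof. by rewrite -scaleN1r dotZr mulN1r. Qed.

Lemma dotBl u v w : dot (u - v) w = dot u w - dot v w.
Proof. by rewrite dotDl dotNl. Qed.

Lemma dotBr u v w : dot w (u - v) = dot w u - dot w v.
Proof. by rewrite dotDr dotNr. Qed.

Lemma dot_mulmx u v : dot u v = (u *m v^T) 0 0.
Proof. by rewrite mxE; apply: eq_bigr => i _; rewrite mxE. Qed.

Lemma dot_ge0 u : 0 <= dot u u.
Proof. by apply: sumr_ge0 => i _; rewrite -expr2 sqr_ge0. Qed.

Lemma dot_eq0 u : dot u u = 0 -> u = 0.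
Proof.
move=> uu0; apply/rowP => i; rewrite mxE.
have /psumr_eq0P : forall j, true -> 0 <= u 0 j * u 0 j.
  by move=> j _; rewrite -expr2 sqr_ge0.
by move=> /(_ uu0 i isT)/eqP; rewrite mulf_eq0 orbb => /eqP.
Qed.

Lemma enorm_ge0 u : 0 <= enorm u.
Proof. exact: sqrtr_ge0. Qed.

Lemma enorm_sqr u : enorm u ^+ 2 = dot u u.
Proof. by rewrite sqr_sqrtr// dot_ge0. Qed.

Lemma enorm0 : enorm (0 : 'rV[R]_d) = 0.
Proof. by rewrite /enorm -(scale0r 0) dotZl mul0r sqrtr0. Qed.

Lemma enorm_eq0 u : enorm u = 0 -> u = 0.
Proof. by move=> u0; apply: dot_eq0; rewrite -enorm_sqr u0 expr0n. Qed.

Lemma enorm_gt0 u : u != 0 -> 0 < enorm u.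
Proof.
by move=> u0; rewrite lt_def enorm_ge0 andbT; apply: contra_neq u0 => /enorm_eq0.
Qed.

Lemma enormZ (k : R) u : enorm (k *: u) = `|k| * enorm u.
Proof.
by rewrite /enorm dotZl dotZr mulrA -expr2 sqrtrM ?sqr_ge0// sqrtr_sqr.
Qed.

Lemma enormN u : enorm (- u) = enorm u.
Proof. by rewrite -scaleN1r enormZ normrN1 mul1r. Qed.

Lemma enorm_subC u v : enorm (u - v) = enorm (v - u).
Proof. by rewrite -enormN opprB. Qed.

Lemma dot_le_enorm u v : dot u v <= enorm u * enorm v.
Proof.
have [->|u0] := eqVneq u 0.
  by rewrite -(scale0r 0) dotZl mul0r mulr_ge0 ?enorm_ge0.
have [->|v0] := eqVneq v 0.
  by rewrite -(scale0r 0) dotZr mul0r mulr_ge0 ?enorm_ge0.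
have := dot_ge0 (enorm v *: u - enorm u *: v).
have -> : dot (enorm v *: u - enorm u *: v) (enorm v *: u - enorm u *: v) =
    2 * (enorm u * enorm v) * (enorm u * enorm v - dot u v).
  by rewrite !(dotBl, dotBr, dotZl, dotZr) -!enorm_sqr (dotC v u); ring.
have := enorm_gt0 u0; have := enorm_gt0 v0 => q0 p0.
by rewrite pmulr_rge0 ?subr_ge0// !mulr_gt0.
Qed.

Lemma normr_dot_le u v : `|dot u v| <= enorm u * enorm v.
Proof.
rewrite ler_norml dot_le_enorm andbT lerNl -dotNr.
by rewrite -[X in _ <= _ * X]enormN dot_le_enorm.
Qed.

Lemma ler_enormD u v : enorm (u + v) <= enorm u + enorm v.
Proof.
rewrite -(@ler_pXn2r _ 2)// ?nnegrE ?addr_ge0 ?enorm_ge0//.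
rewrite enorm_sqr !(dotDl, dotDr) (dotC v u) sqrrD -!enorm_sqr.
by have := dot_le_enorm u v; lra.
Qed.

Lemma ler_enorm_distD v u w : enorm (u - w) <= enorm (u - v) + enorm (v - w).
Proof. by rewrite -{1}(subrK v u) -addrA ler_enormD. Qed.

Lemma enorm_le_sum u : enorm u <= \sum_(i < d) `|u 0 i|.
Proof.
rewrite -(@ler_pXn2r _ 2)// ?nnegrE ?enorm_ge0 ?sumr_ge0//.
rewrite enorm_sqr expr2 mulr_suml; apply: ler_sum => i _.
rewrite (le_trans (ler_norm _))// normrM ler_wpM2l//.
by rewrite (bigD1 i)//= lerDl sumr_ge0.
Qed.

Lemma coord_le_enorm u i : `|u 0 i| <= enorm u.
Proof.
rewrite -(@ler_pXn2r _ 2)// ?nnegrE ?enorm_ge0// enorm_sqr real_normK ?num_real//.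
rewrite /dot (bigD1 i)//= -expr2 lerDl sumr_ge0// => j _.
by rewrite -expr2 sqr_ge0.
Qed.

(** Scaling [u - v] by [(enorm u)^-1 <= 1] costs one distance [enorm (u - v)],
    and correcting the length of the second vector costs another one. *)
Lemma enorm_normalize_sub u v : 1 <= enorm u -> 0 < enorm v ->
  enorm ((enorm u)^-1 *: u - (enorm v)^-1 *: v) <= 2 * enorm (u - v).
Proof.
move=> u1 v0; have u0 : 0 < enorm u by rewrite (lt_le_trans ltr01).
have -> : (enorm u)^-1 *: u - (enorm v)^-1 *: v =
    (enorm u)^-1 *: (u - v) + ((enorm u)^-1 - (enorm v)^-1) *: v.
  by rewrite scalerBr scalerBl addrA subrK.
have uv : `|enorm v - enorm u| <= enorm (u - v).
  rewrite ler_norml; have := ler_enormD (u - v) v.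
  have := ler_enormD (v - u) u; rewrite !subrK (enorm_subC v).
  by move=> ? ?; apply/andP; split; lra.
rewrite (le_trans (ler_enormD _ _))// !enormZ mulr_natl mulr2n.
have iu1 : (enorm u)^-1 <= 1 by rewrite invf_le1.
rewrite lerD//.
  by rewrite ger0_norm ?invr_ge0 ?enorm_ge0// ler_piMl ?enorm_ge0.
have -> : (enorm u)^-1 - (enorm v)^-1 =
    (enorm v - enorm u) * (enorm u)^-1 * (enorm v)^-1.
  by field; rewrite !gt_eqF.
rewrite !normrM !normfV !(ger0_norm (enorm_ge0 _)) divfK ?gt_eqF//.
by rewrite -[leRHS]mulr1 ler_pM// invr_ge0 enorm_ge0.
Qed.

Lemma dot_continuous u : continuous (dot u : 'rV[R]_d -> R).
Proof.
move=> x; apply: (@cvg_big _ _ _ _ _ (@add_continuous R) _ (nbhs x)) => i _.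
by apply: cvgM; [exact: cvg_cst | exact: coord_continuous].
Qed.

Lemma enorm_continuous : continuous (enorm : 'rV[R]_d -> R).
Proof.
move=> x; apply: continuous_comp; last exact: sqrt_continuous.
apply: (@cvg_big _ _ _ _ _ (@add_continuous R) _ (nbhs x)) => i _.
by apply: cvgM; exact: coord_continuous.
Qed.

Lemma halfspace_closed u (c : R) : closed [set x : 'rV[R]_d | dot u x <= c].
Proof.
apply: (@preimage_closed _ _ (dot u) [set t | t <= c]) => [x _|].
  exact: dot_continuous.
exact: closed_le.
Qed.

Lemma halfspace_open u (c : R) : open [set x : 'rV[R]_d | c < dot u x].
Proof.
apply: (@open_comp _ _ (dot u) [set t | c < t]) => [x _|].
  exact: dot_continuous.
exact: open_gt.
Qed.

Lemma enorm_sub_continuous a : continuous (fun x : 'rV[R]_d => enorm (x - a)).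
Proof.
move=> x; apply: continuous_comp; last exact: enorm_continuous.
by apply: continuousB; [exact: (cvg_id : id y @[y --> x] --> id x) | exact: cst_continuous].
Qed.

Lemma eball_closed a (rho : R) : closed (eball a rho).
Proof.
apply: (@preimage_closed _ _ (fun x => enorm (x - a)) [set t | t <= rho]).
  by move=> x _; exact: enorm_sub_continuous.
exact: closed_le.
Qed.

Lemma esphere_closed : closed (esphere : set 'rV[R]_d).
Proof.
apply: (@preimage_closed _ _ enorm [set t | t = 1]) => [x _|].
  exact: enorm_continuous.
exact: closed_eq.
Qed.

Lemma convex_setE A : convex_set A -> forall (k : R) x y, 0 <= k -> k <= 1 ->
  A x -> A y -> A (k *: x + (1 - k) *: y).
Proof.
move=> cA k x y k0 k1 Ax Ay.
have k01 : Itv.spec (@Itv.num_sem R)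
    (Itv.Real (Interval (BLeft 0%Z) (BRight 1%Z))) k.
  by rewrite /Itv.spec/= /Itv.num_sem/= num_real/= in_itv/= k0 k1.
have := cA x y (Itv.mk k01); rewrite !inE => /(_ Ax Ay).
by rewrite /conv/=.
Qed.

End euclidean_lemmas.

(** * Support functions and the Hausdorff distance *)

Section support_functions.
Context {R : realType} {d : nat}.
Implicit Types (u v x y p g : 'rV[R]_d) (A : set 'rV[R]_d).

Definition support A u : R := sup [set dot u y | y in A].

Lemma support_attained A u : compact A -> A !=set0 ->
  exists2 p, A p & support A u = dot u p /\ forall y, A y -> dot u y <= dot u p.
Proof.
move=> cA A0.
have [p] := compact_EVT_max A0 cA (continuous_subspaceT (@dot_continuous R d u)).
rewrite inE => Ap pmax; exists p => //.
have up y : A y -> dot u y <= dot u p by move=> Ay; apply: pmax; rewrite inE.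
split=> //; apply/le_anti/andP; split.
  by apply: ge_sup => [|_ [y Ay <-]]; [exists (dot u p), p | exact: up].
by apply: ub_le_sup; [exists (dot u p) => _ [y Ay <-]; exact: up | exists p].
Qed.

Lemma dot_le_support A u y : compact A -> A y -> dot u y <= support A u.
Proof.
by move=> cA Ay; have [|p _ [-> ->]] := @support_attained A u cA; first by exists y.
Qed.

Lemma parallel_setI A (e : R) x y :
  0 < e -> A y -> enorm (x - y) <= e -> parallel_set A e x.
Proof.
move=> e0 Ay xy; exists y => //; exists (e^-1 *: (x - y)).
  rewrite /eball/= subr0 enormZ gtr0_norm ?invr_gt0// mulrC.
  by rewrite ler_pdivrMr// mul1r.
by rewrite scalerA divff ?gt_eqF// scale1r addrC subrK.
Qed.

(** Variational inequality for the metric projection onto a convex set: moving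
    from [p] towards [g] by a fraction [k] changes the squared distance by
    [k ^+ 2 * q - 2 * k * s], which would be negative at [k = s / q]. *)
Lemma nearest_point_dot_le0 A x p g : convex_set A -> A p -> A g ->
  (forall y, A y -> enorm (x - p) <= enorm (x - y)) -> dot (x - p) (g - p) <= 0.
Proof.
move=> cA Ap Ag pmin; rewrite leNgt; apply/negP => s0.
set s := dot _ _ in s0; pose q := dot (g - p) (g - p).
have key (k : R) : 0 <= k -> k <= 1 -> 2 * k * s <= k ^+ 2 * q.
  move=> k0 k1; have := pmin _ (convex_setE cA k0 k1 Ag Ap).
  have -> : x - (k *: g + (1 - k) *: p) = (x - p) - k *: (g - p).
    by apply/rowP => i; rewrite !mxE; ring.
  rewrite -(@ler_pXn2r _ 2)// ?nnegrE ?enorm_ge0// !enorm_sqr.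
  have -> : dot (x - p - k *: (g - p)) (x - p - k *: (g - p)) =
      dot (x - p) (x - p) - 2 * k * s + k ^+ 2 * q.
    rewrite (dotBl (x - p) (k *: (g - p))) 2!(dotBr (x - p) (k *: (g - p))).
    by rewrite !(dotZl, dotZr) (dotC (g - p) (x - p)) -/s -/q; ring.
  by move=> ?; lra.
have sq : 2 * s <= q by have := key 1 ler01 (lexx 1); lra.
have q0 : 0 < q by lra.
have k1 : s / q <= 1 by rewrite ler_pdivrMr// mul1r; lra.
have := key (s / q) (ltW (divr_gt0 s0 q0)) k1.
have -> : (s / q) ^+ 2 * q = s / q * s by field; rewrite gt_eqF.
have : 0 < s / q * s by rewrite mulr_gt0// divr_gt0.
lra.
Qed.

(** If the half-spaces with outer normals [u j] are shifted from the supporting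
    half-spaces of [A] by at most [lo] inwards and [up] outwards, shrinking [A]
    towards the centre [a] of its inscribed ball by the factor [1 - lo / r]
    puts it inside the polytope.  Conversely a point [x] of the polytope is
    compared with its projection [p] onto [A] in the direction [x - p], which
    is [delta]-close to some [u j]. *)
Lemma hausdorff_polytope_le A a (r rmax lo up delta e : R) (M : nat)
    (u : 'I_M -> 'rV[R]_d) (k : 'I_M -> R) :
  convex_body A -> 0 < r -> eball a r `<=` A -> A `<=` eball 0 rmax ->
  (forall j, enorm (u j) = 1) ->
  (forall j, support A (u j) - lo <= k j <= support A (u j) + up) ->
  0 <= lo -> lo <= r -> delta <= 1 ->
  (forall v, enorm v = 1 -> exists j, enorm (v - u j) <= delta) ->
  0 < e -> 2 * rmax * lo / r <= e -> 2 * up + 4 * rmax * delta <= e ->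
  (hausdorff_dist [set x | forall j, (dot (u j) x <= k j)%R] A <= e%:E)%E.
Proof.
move=> [cA kA _] r0 arA AR u1 ku lo0 lor delta1 net e0 e_lo e_up.
have Aa : A a by apply: arA; rewrite /eball/= subrr enorm0 ltW.
have diam y g : A y -> A g -> enorm (y - g) <= 2 * rmax.
  move=> /AR; rewrite /eball/= subr0 => yR /AR; rewrite /eball/= subr0 => gR.
  by have := ler_enormD y (- g); rewrite enormN; lra.
apply: ereal_inf_lbound; exists e => //; split=> // [x xk|g Ag].
- have [p] := compact_EVT_min (ex_intro _ a Aa) kA
    (continuous_subspaceT (@enorm_sub_continuous R d x)).
  rewrite inE => Ap pmin.
  have {}pmin y : A y -> enorm (x - p) <= enorm (x - y).
    by move=> Ay; rewrite !(enorm_subC x) pmin// inE.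
  apply: (parallel_setI e0 Ap); rewrite leNgt; apply/negP => eD.
  set D := enorm (x - p) in eD; have D0 : 0 < D by exact: lt_trans eD.
  pose v := D^-1 *: (x - p).
  have v1 : enorm v = 1.
    by rewrite enormZ gtr0_norm ?invr_gt0// mulVf// gt_eqF.
  have [j vj] := net v v1.
  have [g Ag [hg _]] := support_attained (u j) kA (ex_intro _ a Aa).
  have : dot v (g - p) <= 0.
    rewrite dotZl pmulr_rle0 ?invr_gt0//.
    exact: (nearest_point_dot_le0 cA Ap Ag pmin).
  have : dot (u j - v) (g - p) <= delta * (2 * rmax).
    rewrite (le_trans (dot_le_enorm _ _))// ler_pM ?enorm_ge0//.
      by rewrite enorm_subC.
    exact: diam.
  have uv : 1 / 2 <= dot (u j) v.
    have : enorm (v - u j) ^+ 2 <= 1.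
      rewrite -(expr1n _ 2) ler_pXn2r// ?nnegrE ?enorm_ge0//.
      exact: le_trans delta1.
    rewrite enorm_sqr dotBl !dotBr -!enorm_sqr v1 u1 (dotC v (u j)).
    by lra.
  have : dot (u j) x = dot (u j) p + D * dot (u j) v.
    by rewrite dotZr mulrA divff ?gt_eqF// mul1r dotBr addrC subrK.
  have : D * (1 / 2) <= D * dot (u j) v by rewrite ler_pM2l.
  have /andP[_] := ku j; have := xk j; rewrite hg dotBl !dotBr.
  by lra.
- pose l := lo / r; have l0 : 0 <= l by rewrite divr_ge0// ltW.
  have l1 : l <= 1 by rewrite ler_pdivrMr// mul1r.
  apply: (@parallel_setI _ _ _ (l *: a + (1 - l) *: g)) => // [j|].
    have : dot (u j) (a + r *: u j) <= support A (u j).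
      apply: dot_le_support => //; apply: arA.
      by rewrite /eball/= addrC addKr enormZ u1 mulr1 gtr0_norm.
    rewrite dotDr dotZr -enorm_sqr u1 expr1n mulr1 => ha.
    have hg := dot_le_support (u j) kA Ag; have /andP[lok _] := ku j.
    rewrite dotDr !dotZr (le_trans _ lok)//.
    have -> : support A (u j) - lo =
        l * (support A (u j) - r) + (1 - l) * support A (u j).
      by rewrite /l; field; rewrite gt_eqF.
    by rewrite lerD// ler_wpM2l//; lra.
  have -> : g - (l *: a + (1 - l) *: g) = l *: (g - a).
    by apply/rowP => i; rewrite !mxE; ring.
  rewrite enormZ ger0_norm// (le_trans _ e_lo)//.
  have -> : 2 * rmax * lo / r = l * (2 * rmax) by rewrite /l; ring.
  by rewrite ler_wpM2l// diam.
Qed.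

End support_functions.

(** * Nets and rotations of the sphere *)

Section sphere_nets.
Context {R : realType}.

Lemma grid_approx (K : nat) (t : R) : (0 < K)%N -> -1 <= t -> t <= 1 ->
  exists k : 'I_(2 * K).+1, `|t - (k%:R / K%:R - 1)| <= K%:R^-1.
Proof.
move=> K0 t1 t2; have K0' : 0 < K%:R :> R by rewrite ltr0n.
have s0 : 0 <= (t + 1) * K%:R by rewrite mulr_ge0 ?ler0n//; lra.
have /andP[kl kr] := Num.Theory.truncn_itv s0.
have kK : (Num.truncn ((t + 1) * K%:R) < (2 * K).+1)%N.
  rewrite ltnS -(ler_nat R) (le_trans kl)// natrM ler_wpM2r ?ler0n//; lra.
exists (Ordinal kK) => /=; set k := Num.truncn _ in kl kr *.
have -> : t - (k%:R / K%:R - 1) = ((t + 1) * K%:R - k%:R) / K%:R.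
  by field; rewrite gt_eqF.
rewrite normrM normfV (gtr0_norm K0') ler_piMl ?invr_ge0 ?ler0n//.
by rewrite ger0_norm ?subr_ge0// lerBlDr nat1r ltW.
Qed.

Variable d : nat.

(** A point of the boundary of the cube [-1, 1]^(d+1): a face is given by a
    coordinate and a sign, the other [d] coordinates run over a grid. *)
Definition cube_face_point (K : nat)
    (c : 'I_d.+1 * bool * {ffun 'I_d -> 'I_(2 * K).+1}) : 'rV[R]_d.+1 :=
  \row_j (if unlift c.1.1 j is Some k then (c.2 k)%:R / K%:R - 1
          else (-1) ^+ c.1.2).

Lemma enorm_cube_face_point K c : 1 <= enorm (@cube_face_point K c).
Proof.
rewrite (le_trans _ (coord_le_enorm _ c.1.1))//.
by rewrite mxE unlift_none normrX normrN1 expr1n.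
Qed.

(** The exponent is the dimension [d] of the sphere because the net is the
    radial projection of grids on the faces of the cube. *)
Lemma sphere_net (delta : R) : 0 < delta -> delta <= 1 ->
  exists (N : nat) (u : 'I_N -> 'rV[R]_d.+1),
  [/\ forall i, enorm (u i) = 1,
      forall v, enorm v = 1 -> exists i, enorm (v - u i) <= delta &
      N%:R <= 2 * d.+1%:R * ((4 * d.+1%:R + 3) / delta) ^+ d].
Proof.
move=> delta0 delta1; pose D : R := d.+1%:R.
have D0 : 0 < D by rewrite ltr0n.
(* [2 * D / K] bounds the error: mesh [K^-1] in each of at most [D] coordinates,
   doubled by the radial projection *)
pose K := (Num.truncn (2 * D / delta)).+1.
have /andP[Kl Kr] : (K.-1)%:R <= 2 * D / delta < K%:R.
  by apply: Num.Theory.truncn_itv; rewrite divr_ge0 ?mulr_ge0 ?ltW.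
have K0 : 0 < K%:R :> R by rewrite ltr0n.
pose I : finType := ('I_d.+1 * bool * {ffun 'I_d -> 'I_(2 * K).+1})%type.
pose g (c : I) := (enorm (cube_face_point c))^-1 *: cube_face_point c.
have g1 c : enorm (g c) = 1.
  have g0 := lt_le_trans ltr01 (enorm_cube_face_point c).
  by rewrite enormZ gtr0_norm ?invr_gt0// mulVf// gt_eqF.
exists #|I|, (g \o enum_val); split=> [i|v v1|]; first exact: g1.
- suff [c vc] : exists c, enorm (v - g c) <= delta.
    by exists (enum_rank c); rewrite /= enum_rankK.
  have [i _ imax] := arg_maxP (fun i => `|v 0 i|)
    (erefl : xpredT (ord0 : 'I_d.+1)).
  pose m : R := `|v 0 i|.
  have m0 : 0 < m.
    rewrite lt_def normr_ge0 andbT; apply/eqP => mi0.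
    have v0 : v = 0.
      apply/rowP => j; rewrite mxE; apply/normr0_eq0/le_anti.
      by rewrite normr_ge0 andbT -mi0; exact: imax.
    by have := v1; rewrite v0 enorm0 => /eqP; rewrite eq_sym oner_eq0.
  pose w : 'rV[R]_d.+1 := m^-1 *: v.
  have wj j : `|w 0 j| <= 1.
    rewrite mxE normrM (gtr0_norm (_ : 0 < m^-1)) ?invr_gt0//.
    by rewrite mulrC ler_pdivrMr// mul1r; exact: imax.
  have wN : enorm w = m^-1 by rewrite enormZ v1 mulr1 gtr0_norm ?invr_gt0.
  have w1 : 1 <= enorm w.
    by rewrite wN invf_ge1// -v1 coord_le_enorm.
  have vw : v = (enorm w)^-1 *: w.
    by rewrite wN invrK scalerA divff ?gt_eqF// scale1r.
  have wi : w 0 i = (-1) ^+ (v 0 i < 0)%R.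
    by rewrite mxE [v 0 i in LHS]numEsign -/m mulrCA mulVf ?gt_eqF// mulr1.
  have /choice[f fP] (j : 'I_d) : exists k : 'I_(2 * K).+1,
      `|w 0 (lift i j) - (k%:R / K%:R - 1)| <= K%:R^-1.
    have := wj (lift i j); rewrite ler_norml => /andP[w1l w1r].
    exact: (@grid_approx K _ isT).
  pose c : I := (i, (v 0 i < 0)%R, [ffun j => f j]).
  exists c; rewrite [in v - _]vw.
  rewrite (le_trans (enorm_normalize_sub w1 _))//.
    exact: lt_le_trans (enorm_cube_face_point c).
  have coordK j : `|(w - cube_face_point c) 0 j| <= K%:R^-1.
    have -> : (w - cube_face_point c) 0 j = w 0 j - cube_face_point c 0 j.
      by rewrite !mxE.
    rewrite [cube_face_point c 0 j]mxE /=; case: unliftP => [k ->|->].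
      by rewrite ffunE.
    by rewrite wi subrr normr0 invr_ge0 ltW.
  have : enorm (w - cube_face_point c) <= D * K%:R^-1.
    rewrite (le_trans (enorm_le_sum _))// (le_trans (ler_sum _ (fun j _ => coordK j)))//.
    by rewrite sumr_const card_ord mulr_natl.
  have : D * K%:R^-1 * 2 <= delta.
    rewrite mulrAC ler_pdivrMr// mulrC.
    by rewrite mulrC in Kr; move: Kr; rewrite mulrC ltr_pdivrMr//; lra.
  by lra.
- rewrite !card_prod card_ord card_bool card_ffun !card_ord.
  rewrite (mulnC d.+1) !natrM ler_pM2l ?mulr_gt0 ?ltr0n//.
  have le_base : (2 * K).+1%:R <= (4 * D + 3) / delta.
    rewrite ler_pdivlMr// -natr1 natrM.
    have : K%:R <= 2 * D / delta + 1.
      by rewrite -[K%:R]/((K.-1).+1%:R) -natr1 lerD2r.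
    by rewrite -lerBlDr ler_pdivlMr// mulrBl => KD; nra.
  by rewrite natrX lerXn2r// nnegrE ?ler0n// (le_trans _ le_base)// ler0n.
Qed.

End sphere_nets.

Section rotations.
Context {R : realType} {d : nat}.
Implicit Types (u v w x : 'rV[R]_d) (Q : 'M[R]_d).

Lemma enorm_mulmx_orthogonal Q x : Q *m Q^T = 1%:M -> enorm (x *m Q) = enorm x.
Proof.
move=> QQ; rewrite /enorm !dot_mulmx trmx_mul mulmxA -(mulmxA x) QQ.
by rewrite mulmx1.
Qed.

(** The Householder reflection exchanging [u] and [v]. *)
Lemma orthogonal_transitive u v : enorm u = 1 -> enorm v = 1 ->
  exists Q, Q *m Q^T = 1%:M /\ u *m Q = v.
Proof.
move=> u1 v1; have [->|uv] := eqVneq u v.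
  by exists 1%:M; rewrite trmx1 !mulmx1.
pose w := u - v; pose q := dot w w; pose c := 2 / q.
have q0 : 0 < q by rewrite /q -enorm_sqr exprn_gt0// enorm_gt0// subr_eq0.
have ww : w *m w^T = q%:M by rewrite [LHS]mx11_scalar -dot_mulmx.
have cq : c * q = 2 by rewrite divfK// gt_eqF.
pose W := w^T *m w; pose Q := 1%:M - c *: W.
have WW : W *m W = q *: W.
  by rewrite /W mulmxA -(mulmxA w^T w) ww mul_mx_scalar -scalemxAl.
have QT : Q^T = Q.
  by rewrite /Q raddfB/= tr_scalar_mx linearZ/= trmx_mul trmxK.
exists Q; split.
  rewrite QT /Q mulmxBr mulmx1 mulmxBl mul1mx -scalemxAr -scalemxAl WW.
  rewrite !scalerA -mulrA cq -[RHS]subr0; apply/eqP; rewrite -subr_eq0; apply/eqP.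
  by apply/matrixP => i j; rewrite !mxE; ring.
rewrite mulmxBr mulmx1 -scalemxAr mulmxA [u *m w^T]mx11_scalar -dot_mulmx.
rewrite mul_scalar_mx scalerA.
have -> : c * dot u w = 1.
  have q2 : q = 2 * dot u w.
    rewrite /q {1}/w dotBl /w !dotBr -!enorm_sqr u1 v1 (dotC v u) expr1n; ring.
  have := gt_eqF q0; rewrite /c q2 mulf_eq0 pnatr_eq0/= => uw.
  by field; rewrite uw.
by rewrite scale1r /w opprB addrC subrK.
Qed.

End rotations.

(** * Volumes and uniform laws *)

Section volume.
Context {R : realType} {d : nat}.
Implicit Types (x y p q u : 'rV[R]_d) (A B G : set 'rV[R]_d).

Lemma open_measurable_vec A : open A -> measurable (A : set (Rvec R d)).
Proof. exact: sub_sigma_algebra. Qed.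

Lemma closed_measurable_vec A : closed A -> measurable (A : set (Rvec R d)).
Proof.
move=> cA; rewrite -[A]setCK; apply: measurableC.
by apply: open_measurable_vec; rewrite openC.
Qed.

Lemma box_volume_ge0 (a b : 'rV[R]_d) :
  (forall i, a 0 i <= b 0 i) -> 0 <= box_volume a b.
Proof. by move=> ab; apply: prodr_ge0 => i _; rewrite subr_ge0. Qed.

Lemma lebesgue_vec_ge0 A : (0 <= lebesgue_vec A)%E.
Proof.
apply: le_ereal_inf_tmp => _ [c [c12 _] <-].
by apply: nneseries_ge0 => k _ _; rewrite lee_fin box_volume_ge0.
Qed.

Lemma le_lebesgue_vec A B : A `<=` B -> (lebesgue_vec A <= lebesgue_vec B)%E.
Proof.
move=> AB; apply: ereal_inf_le_tmp => _ [c [c12 Bc] <-]; exists c => //.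
by split=> //; exact: subset_trans Bc.
Qed.

(** Pulling a cover by boxes back along [x |-> q + l *: x] divides the volume of
    each box by [l ^+ d]. *)
Lemma lebesgue_vec_homothety A q (l : R) : 0 < l ->
  ((l ^+ d)%:E * lebesgue_vec A <=
   lebesgue_vec [set (q + l *: x)%R | x in A])%E.
Proof.
move=> l0; have ld0 : 0 < l ^+ d by rewrite exprn_gt0.
apply: le_ereal_inf_tmp => _ [c [c12 Ac] <-].
pose pull x := l^-1 *: (x - q).
pose c' k := (pull (c k).1, pull (c k).2).
have vol k : box_volume (c' k).1 (c' k).2 =
    (l ^+ d)^-1 * box_volume (c k).1 (c k).2.
  rewrite /box_volume -exprVn -[X in _ ^+ X]card_ord -prodr_const -big_split/=.
  by apply: eq_bigr => i _; rewrite !mxE; ring.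
rewrite -lee_pdivlMl//.
have -> : ((l ^+ d)^-1%:E *
    \sum_(0 <= k <oo) (box_volume (c k).1 (c k).2)%:E =
    \sum_(0 <= k <oo) (box_volume (c' k).1 (c' k).2)%:E)%E.
  rewrite -nneseriesZl; last by move=> k _ *; rewrite lee_fin box_volume_ge0.
  by apply: eq_eseriesr => k _; rewrite vol EFinM.
apply: ereal_inf_lbound; exists c' => //; split=> [k i|x Ax].
  by rewrite !mxE ler_pM2l ?invr_gt0// lerD2r.
have [k _ bk] := Ac _ (ex_intro2 _ _ x Ax erefl); exists k => // i.
have := bk i; rewrite !mxE => /andP[x1 x2].
by rewrite ler_pdivrMl// ler_pdivlMl//; apply/andP; split; lra.
Qed.

End volume.

Section uniform_laws.
Context {R : realType} {d : nat} {dT : measure_display} {T : measurableType dT}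
  (P : probability T R).
Implicit Types (Z : {RV P >-> Rvec R d}) (G : set 'rV[R]_d).

(** A degenerate volume of the body would give the whole space mass zero. *)
Lemma uniform_on_body_volume_gt0 Z G :
  uniform_on_body Z G -> 0 < fine (lebesgue_vec G).
Proof.
move=> /(_ setT measurableT); rewrite probability_setT setTI.
rewrite lt_def fine_ge0 ?lebesgue_vec_ge0// andbT => -[] E.
by apply/eqP => G0; move: E; rewrite G0 mul0r => /eqP; rewrite oner_eq0.
Qed.

Lemma uniform_on_body_as Z G : closed G -> uniform_on_body Z G ->
  P (Z @^-1` G) = 1%E.
Proof.
move=> cG unif; have G0 := uniform_on_body_volume_gt0 unif.
have -> : P (Z @^-1` G) = distribution P Z G by [].
by rewrite unif ?setIid ?divff ?gt_eqF//; exact: closed_measurable_vec.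
Qed.

(** The body contracted by the factor [l] towards a point where [dot u] is
    maximal lies in the body and in its cap of height [2 * rmax * l]. *)
Lemma uniform_on_body_cap Z G (rmax l : R) (u : 'rV[R]_d) :
  convex_body G -> G `<=` eball 0 rmax -> uniform_on_body Z G ->
  enorm u = 1 -> 0 < l -> l <= 1 ->
  ((l ^+ d)%:E <= P [set w | (support G u - 2 * rmax * l <= dot u (Z w))%R])%E.
Proof.
move=> [cG kG G0] GR unif u1 l0 l1.
pose A : set 'rV[R]_d := [set x | support G u - 2 * rmax * l <= dot u x].
have mA : measurable (A : set (Rvec R d)).
  apply: closed_measurable_vec.
  have -> : A = [set x | dot (- u) x <= 2 * rmax * l - support G u].
    by apply/seteqP; split=> x; rewrite /A/= dotNl; lra.
  exact: halfspace_closed.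
have vG := uniform_on_body_volume_gt0 unif.
have -> : P [set w | support G u - 2 * rmax * l <= dot u (Z w)] =
  distribution P Z A by [].
have [p Gp [hp _]] : exists2 p, G p & support G u = dot u p /\
    forall y, G y -> dot u y <= dot u p.
  by apply: support_attained => //; case: G0 => x /interior_subset; exists x.
rewrite unif// lee_fin ler_pdivlMr//.
have finG : lebesgue_vec G \is a fin_num.
  rewrite ge0_fin_numE ?lebesgue_vec_ge0//.
  by case: (lebesgue_vec G) vG => [v _|/=|/=]; rewrite ?ltry ?ltxx ?ltNyr.
have leAG : (lebesgue_vec (A `&` G) <= lebesgue_vec G)%E.
  by apply: le_lebesgue_vec => x [].
have finAG : lebesgue_vec (A `&` G) \is a fin_num.
  rewrite ge0_fin_numE ?lebesgue_vec_ge0//.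
  by rewrite (le_lt_trans leAG)// -ge0_fin_numE ?lebesgue_vec_ge0.
rewrite -lee_fin EFinM !fineK//.
apply: le_trans (lebesgue_vec_homothety _ ((1 - l) *: p) l0) _.
apply: le_lebesgue_vec => _ [g Gg <-]; rewrite addrC.
split; last exact: (convex_setE cG (ltW l0) l1).
rewrite /A/= hp dotDr !dotZr.
have : `|dot u (p - g)| <= 2 * rmax.
  rewrite (le_trans (normr_dot_le _ _))// u1 mul1r (le_trans (ler_enormD _ _))//.
  have := GR _ Gp; have := GR _ Gg; rewrite /eball/= !subr0 enormN; lra.
rewrite dotBr ler_norml => /andP[_].
rewrite -(ler_pM2l l0); lra.
Qed.

End uniform_laws.

(** * Gaussian tails *)

Section gaussian_tails.
Context {R : realType}.
Implicit Types (m z s : R).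
Local Notation mu := (@lebesgue_measure R).

Lemma measurable_normal_pdf_EFin (D : set R) m s :
  measurable_fun D (fun y => (normal_pdf m s y)%:E).
Proof.
apply: measurable_funTS; apply/measurable_EFinP.
exact: measurable_normal_pdf.
Qed.

(** On [z, +oo[ the centered density is at most [expR (- z ^+ 2 / (2 s ^+ 2))]
    times the density centered at [z], because
    [z ^+ 2 + (y - z) ^+ 2 <= y ^+ 2] there. *)
Lemma normal_prob_tail_le s z : 0 < s -> 0 <= z ->
  (normal_prob 0 s `[z, +oo[ <= (expR (- (z ^+ 2 / (2 * s ^+ 2))))%:E)%E.
Proof.
move=> s0 z0; set e := expR _.
apply: (@le_trans _ _
    (\int[mu]_(y in `[z, +oo[) (e%:E * (normal_pdf z s y)%:E))%E).
  apply: ge0_le_integral => //=.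
  - by move=> y _; rewrite lee_fin normal_pdf_ge0.
  - exact: measurable_normal_pdf_EFin.
  - apply: measurable_funeM; exact: measurable_normal_pdf_EFin.
  move=> y; rewrite in_itv/= andbT => zy; rewrite -EFinM lee_fin.
  rewrite !normal_pdfE ?gt_eqF//= mulrCA ler_wpM2l ?normal_peak_ge0//.
  rewrite /normal_fun /e -expRD ler_expR subr0 -[s ^+ 2 *+ 2]mulr_natl.
  have i0 : 0 < (2 * s ^+ 2)^-1 by rewrite invr_gt0 mulr_gt0 ?exprn_gt0.
  have : 0 <= z * (y - z) * (2 * s ^+ 2)^-1.
    by rewrite !mulr_ge0 ?subr_ge0// ltW.
  by rewrite !expr2; lra.
rewrite ge0_integralZl//=.
- rewrite -[leRHS]mule1 lee_wpmul2l ?lee_fin ?expR_ge0//.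
  exact: (probability_le1 (normal_prob z s)).
- exact: measurable_normal_pdf_EFin.
- by move=> y _; rewrite lee_fin normal_pdf_ge0.
- by rewrite lee_fin expR_ge0.
Qed.

Lemma normal_prob_tail_ge s z delta q : 0 < s -> 0 < delta ->
  (forall y, z <= y -> y <= z + delta -> y ^+ 2 <= q) ->
  ((delta * (normal_peak s * expR (- (q / (2 * s ^+ 2)))))%:E <=
   normal_prob 0 s `[z, +oo[)%E.
Proof.
move=> s0 delta0 yq; set c := _ * expR _.
have c0 : 0 <= c by rewrite mulr_ge0 ?normal_peak_ge0 ?expR_ge0.
apply: (@le_trans _ _ (normal_prob 0 s `[z, (z + delta)%R])); last first.
  apply: le_measure; rewrite ?inE// => y /=; rewrite !in_itv/= andbT.
  by case/andP.
have -> : (delta * c)%:E = (\int[mu]_(y in `[z, (z + delta)%R]) c%:E)%E.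
  rewrite integral_cst//= lebesgue_measure_itv/= lte_fin ltrDl delta0.
  by rewrite -EFinD -EFinM addrAC subrr add0r mulrC.
apply: ge0_le_integral => //=.
- exact: measurable_normal_pdf_EFin.
- move=> y; rewrite in_itv/= => /andP[zy yz]; rewrite lee_fin.
  rewrite normal_pdfE ?gt_eqF//= ler_wpM2l ?normal_peak_ge0//.
  rewrite /normal_fun ler_expR subr0 -[s ^+ 2 *+ 2]mulr_natl mulNr lerN2.
  by rewrite ler_wpM2r ?yq// invr_ge0 mulr_ge0 ?exprn_ge0// ltW.
Qed.

End gaussian_tails.

Section gaussian_vectors.
Context {R : realType} {d : nat} {dT : measure_display} {T : measurableType dT}
  (P : probability T R).

Lemma gaussian_vector_direction (Z : {RV P >-> Rvec R d}) (sigma : R)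
    (u : 'rV[R]_d) (A : set R) :
  0 < sigma -> gaussian_vector Z 0 (sigma ^+ 2)%:M -> enorm u = 1 ->
  measurable A -> P [set w | A (dot u (Z w))] = normal_prob 0 sigma A.
Proof.
move=> s0 gZ u1 mA; rewrite gZ// /normal_law.
have -> : dot u 0 = 0 by rewrite -(scale0r 0) dotZr mul0r.
rewrite mul_mx_scalar -scalemxAl mxE -dot_mulmx -enorm_sqr u1 expr1n mulr1.
by rewrite sqrf_eq0 gt_eqF// sqrtr_sqr gtr0_norm.
Qed.

End gaussian_vectors.

(** * Exceptional events and independence *)

Section exceptional_events.
Context {R : realType} {dT : measure_display} {T : measurableType dT}
  (P : probability T R).
Implicit Types (p q e : R) (S B : set T).

Lemma finite_bigsetUP (I : finType) (B : I -> set T) w :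
  (\big[setU/set0]_i B i) w <-> exists i, B i w.
Proof.
split=> [|[i Bi]]; last by rewrite (bigD1 i)//=; left.
by elim/big_ind: _ => // [A C IA IC [/IA|/IC]//|i _ Bi]; exists i.
Qed.

Lemma finite_bigsetU_measurable (I : finType) (B : I -> set T) :
  (forall i, measurable (B i)) -> measurable (\big[setU/set0]_i B i).
Proof.
move=> mB; elim/big_ind: _ => // [A C]; exact: measurableU.
Qed.

Lemma le_measure_finite_bigsetU (I : finType) (B : I -> set T) :
  (forall i, measurable (B i)) ->
  (P (\big[setU/set0]_i B i) <= \sum_i P (B i))%E.
Proof.
move=> mB.
suff [] : measurable (\big[setU/set0]_i B i) /\
  (P (\big[setU/set0]_i B i) <= \sum_i P (B i))%E by [].
elim/big_rec2: _ => [|i s A _ [mA PA]]; first by rewrite measure0.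
split; first exact: measurableU.
by rewrite (le_trans (measureU2 _ _ _))// leeD2l.
Qed.

(** [S] need not be measurable: it only has to contain the complement of a
    measurable event of probability at most [p]. *)
Definition fails_at_most p S := exists B,
  [/\ measurable B, (P B <= p%:E)%E & ~` B `<=` S].

Lemma fails_at_mostW p q S S' :
  p <= q -> S `<=` S' -> fails_at_most p S -> fails_at_most q S'.
Proof.
move=> pq SS' [B [mB PB BS]]; exists B; split=> //.
  by rewrite (le_trans PB)// lee_fin.
exact: subset_trans SS'.
Qed.

Lemma fails_at_most_null S : measurable S -> P S = 1%E -> fails_at_most 0 S.
Proof.
move=> mS PS; exists (~` S); split; first exact: measurableC.
  by rewrite probability_setC// PS subee.
by rewrite setCK.
Qed.

Lemma fails_at_most_setC p S :
  measurable S -> fails_at_most p S -> (P (~` S) <= p%:E)%E.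
Proof.
move=> mS [B [mB PB BS]]; apply: le_trans PB.
by apply: le_measure; rewrite ?inE//; [exact: measurableC | exact: subsetCl].
Qed.

Lemma fails_at_mostI p q S S' : fails_at_most p S -> fails_at_most q S' ->
  fails_at_most (p + q) (S `&` S').
Proof.
move=> [B [mB PB BS]] [C [mC PC CS]]; exists (B `|` C); split.
- exact: measurableU.
- by rewrite (le_trans (measureU2 _ _ _))// EFinD leeD.
- by move=> w; rewrite setCU => -[/BS ? /CS ?].
Qed.

Lemma fails_at_most_forall (I : finType) p (S : I -> set T) :
  (forall i, fails_at_most p (S i)) ->
  fails_at_most (#|I|%:R * p) [set w | forall i, S i w].
Proof.
move=> /choice[B BP]; have mB i : measurable (B i) by case: (BP i).
exists (\big[setU/set0]_i B i); split; first exact: finite_bigsetU_measurable.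
- rewrite (le_trans (le_measure_finite_bigsetU mB))//.
  rewrite mulr_natl -sumr_const -sumEFin; apply: lee_sum => i _.
  by case: (BP i).
- move=> w Bw i; case: (BP i) => _ _; apply.
  by apply: contra_not Bw => Bi; apply/finite_bigsetUP; exists i.
Qed.

(** The events [n < f] decrease to the empty set, as [f] takes finite values. *)
Lemma fails_at_most_tight (f : T -> R) e : measurable_fun setT f -> 0 < e ->
  exists K, 0 <= K /\ fails_at_most e [set w | f w <= K].
Proof.
move=> mf e0.
pose F n := f @^-1` `]n%:R, +oo[%classic.
have mF n : measurable (F n) by rewrite -[F n]setTI; exact: mf.
have cvF : P (F n) @[n --> \oo] --> 0%E.
  rewrite -(measure0 P); have <- : \bigcap_n F n = set0.
    rewrite -subset0 => w /(_ (Num.bound `|f w|) I).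
    rewrite /F/= in_itv/= andbT ltNge => /negP; apply.
    apply/ltW/(le_lt_trans (ler_norm _)); exact: archi_boundP.
  apply: nonincreasing_cvg_mu => //=.
  - by rewrite (le_lt_trans (probability_le1 _ _)) ?ltry.
  - exact: bigcap_measurable.
  - move=> m n mn; apply/subsetPset => w; rewrite /F/= !in_itv/= !andbT.
    by apply: le_lt_trans; rewrite ler_nat.
have : \forall n \near \oo, (P (F n) < e%:E)%E.
  by apply: (cvF [set x | (x < e%:E)%E]); apply: open_nbhs_nbhs; split;
    [exact: open_ereal_lt_ereal | rewrite /= lte_fin].
move=> [n _ /(_ n (leqnn n))/= Fn]; exists n%:R; split; first by rewrite ler0n.
exists (F n); split=> //; first exact: ltW.
by move=> w; rewrite /F/= in_itv/= andbT => /negP; rewrite -leNgt.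
Qed.

End exceptional_events.

Section independence_lemmas.
Context {R : realType} {dT dS : measure_display} {T : measurableType dT}
  {S : measurableType dS} (P : probability T R).

Lemma g_sigma_preimage_setC n (Z : 'I_n -> T -> S) (A : set T) :
  g_sigma_preimage Z A -> g_sigma_preimage Z (~` A).
Proof.
have [_ C _] := smallest_sigma_algebra setT
  (\big[setU/set0]_(i < n) preimage_set_system setT (Z i) measurable).
by move=> gA; rewrite -setTD; exact: (C A).
Qed.

Lemma g_sigma_preimage_coord n (Z : 'I_n -> T -> S) i (A : set S) :
  measurable A -> g_sigma_preimage Z (Z i @^-1` A).
Proof.
move=> mA; apply: (@sub_sigma_algebra _ setT); rewrite (bigD1 i)//=; left.
by exists A => //; rewrite setTI.
Qed.

Lemma g_sigma_preimage_forall n (Z : 'I_n -> T -> S) (J : {set 'I_n})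
    (A : 'I_n -> set S) : (forall i, measurable (A i)) ->
  g_sigma_preimage Z [set w | forall i, i \in J -> A i (Z i w)].
Proof.
move=> mA.
have [S0 _ U] := smallest_sigma_algebra setT
  (\big[setU/set0]_(i < n) preimage_set_system setT (Z i) measurable).
pose F k := if insub k is Some i then
  if i \in J then ~` (Z i @^-1` A i) else set0 else set0.
have -> : [set w | forall i, i \in J -> A i (Z i w)] = ~` (\bigcup_k F k).
  apply/seteqP; split=> w /= Aw.
    case=> k _; rewrite /F; case: insubP => // i _ _.
    by case: ifPn => // /Aw.
  move=> i iJ; apply: contrapT => Ai; apply: Aw; exists (val i) => //.
  by rewrite /F valK iJ.
apply: g_sigma_preimage_setC; apply: (U F) => k; rewrite /F.
case: insubP => // i _ _; case: ifP => // _.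
apply: g_sigma_preimage_setC; apply: g_sigma_preimage_coord; exact: mA.
Qed.

(** Splitting according to the random set [J] of the indices with
    [X j \in A], the probability is at most the sum over [J] of
    [\prod_j (if j \in J then p j * (1 - q j) else 1 - p j)], which
    factors as [\prod_j (1 - p j * q j)]. *)
Lemma independent_pairs_avoid n (X Y : 'I_n -> T -> S) (A B : set S)
    (p q : R) :
  (forall j, measurable_fun setT (X j)) ->
  (forall j, measurable_fun setT (Y j)) ->
  mutually_independent P X -> mutually_independent P Y ->
  independent_families P X Y -> measurable A -> measurable B ->
  0 <= p -> 0 <= q ->
  (forall j, (p%:E <= P (X j @^-1` A))%E) ->
  (forall j, (q%:E <= P (Y j @^-1` B))%E) ->
  fails_at_most P ((1 - p * q) ^+ n)
    [set w | exists j, A (X j w) /\ B (Y j w)].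
Proof.
move=> mX mY iX iY iXY mA mB p0 q0 pA qB.
have mXA j (C : set S) : measurable C -> measurable (X j @^-1` C).
  by move=> mC; rewrite -[_ @^-1` _]setTI; exact: mX.
have mYB j (C : set S) : measurable C -> measurable (Y j @^-1` C).
  by move=> mC; rewrite -[_ @^-1` _]setTI; exact: mY.
pose pj j := fine (P (X j @^-1` A)); pose qj j := fine (P (Y j @^-1` B)).
have PA j : P (X j @^-1` A) = (pj j)%:E.
  by rewrite fineK// fin_num_measure//; exact: mXA.
have PB j : P (Y j @^-1` B) = (qj j)%:E.
  by rewrite fineK// fin_num_measure//; exact: mYB.
pose AJ (J : {set 'I_n}) j := if j \in J then A else ~` A.
have mAJ J j : measurable (AJ J j).
  by rewrite /AJ; case: ifP => // _; exact: measurableC.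
pose EX (J : {set 'I_n}) :=
  [set w | forall j, j \in [set: 'I_n]%SET -> AJ J j (X j w)].
pose EY (J : {set 'I_n}) := [set w | forall j, j \in J -> (~` B) (Y j w)].
have gX J : g_sigma_preimage X (EX J) 
  by exact: (@g_sigma_preimage_forall n X [set: 'I_n]%SET (AJ J) (mAJ J)).
have gY J : g_sigma_preimage Y (EY J).
  by exact: (@g_sigma_preimage_forall n Y J (fun=> ~` B) (fun=> measurableC mB)).
have mforall (Z : 'I_n -> T -> S) (J : {set 'I_n}) (C : 'I_n -> set S) :
    (forall j (D : set S), measurable D -> measurable (Z j @^-1` D)) ->
    (forall j, measurable (C j)) ->
    measurable [set w | forall j, j \in J -> C j (Z j w)].
  move=> mZ mC; rewrite -[X in measurable X]setCK; apply: measurableC.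
  rewrite (_ : ~` _ = \big[setU/set0]_j
      (if j \in J then Z j @^-1` (~` C j) else set0)).
    apply: finite_bigsetU_measurable => j; case: ifP => // _.
    by apply: mZ; exact: measurableC.
  apply/seteqP; split=> w.
    move=> /existsNP[j /not_implyP[jJ Cj]]; apply/finite_bigsetUP.
    by exists j; rewrite jJ.
  move=> /finite_bigsetUP[j]; case: ifP => // jJ Cj /(_ j jJ).
  exact: Cj.
have mE J : measurable (EX J `&` EY J).
  apply: measurableI; first exact: (mforall X _ (AJ J) mXA (mAJ J)).
  exact: (mforall Y _ (fun=> ~` B) mYB (fun=> measurableC mB)).
exists (\big[setU/set0]_(J : {set 'I_n}) (EX J `&` EY J)); split.
- exact: finite_bigsetU_measurable.
- rewrite (le_trans (le_measure_finite_bigsetU P mE))//.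
  pose t (J : {set 'I_n}) j := if j \in J then pj j * (1 - qj j) else 1 - pj j.
  rewrite (eq_bigr (fun J => (\prod_j t J j)%:E)); last first.
    move=> J _; rewrite (iXY _ _ (gX J) (gY J)).
    rewrite (iX [set: 'I_n]%SET (AJ J) (mAJ J)).
    rewrite (iY J (fun=> ~` B) (fun=> measurableC mB)).
    rewrite [X in (X * _)%E](eq_bigl xpredT); last by move=> j; exact: finset.in_setT.
    rewrite [X in (_ * X)%E]big_mkcond -big_split/= -prodEFin.
    apply: eq_bigr => j _; rewrite /t /AJ; case: ifP => _.
      rewrite PA preimage_setC probability_setC ?PB; last exact: mYB.
      by rewrite -EFinB -EFinM.
    by rewrite mule1 preimage_setC probability_setC ?PA//; exact: mXA.
  rewrite sumEFin lee_fin.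
  have -> : \sum_(J : {set 'I_n}) \prod_j t J j = \prod_j (1 - pj j * qj j).
    rewrite -(bigA_distr 1 +%R); apply: eq_bigr => j _. by rewrite /=; ring.
  have -> : (1 - p * q) ^+ n = \prod_(j < n) (1 - p * q).
    by rewrite prodr_const card_ord.
  apply: ler_prod => j _.
  have pj1 : pj j <= 1.
    by rewrite -lee_fin -PA; exact/probability_le1/mXA.
  have qj1 : qj j <= 1.
    by rewrite -lee_fin -PB; exact/probability_le1/mYB.
  have ppj : p <= pj j by rewrite -lee_fin -PA.
  have qqj : q <= qj j by rewrite -lee_fin -PB.
  by nra.
- move=> w Ew; apply: contrapT => /forallNP nAB; apply: Ew.
  apply/finite_bigsetUP; exists [set j | `[< A (X j w) >]]%SET; split=> j.
    by move=> _; rewrite /AJ inE; case: asboolP.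
  by rewrite inE => /asboolP Aj Bj; exact: (nAB j).
Qed.

(** Conditioning on the random direction [U k], without product measures: the
    range of [U k] is cut into disjointified cells, and on each of them the
    statement about [Y] is required at the index of that cell only. *)
Lemma independent_cells n M N (Y : 'I_n -> T -> S) (U : 'I_M -> T -> S) k
    (C : 'I_N -> set S) (W : 'I_N -> set T) (p : R) :
  measurable_fun setT (U k) ->
  independent_families P Y U -> (forall i, measurable (C i)) ->
  (forall i, g_sigma_preimage Y (W i)) -> (forall i, measurable (W i)) ->
  (forall i, fails_at_most P p (W i)) -> 0 <= p ->
  fails_at_most P p [set w | (exists i, C i (U k w)) ->
    exists i, C i (U k w) /\ W i w].
Proof.
move=> mU iYU mC gW mW PW p0.
pose V i := ~` W i.
have gV i : g_sigma_preimage Y (V i) by exact: g_sigma_preimage_setC.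
have mV i : measurable (V i) by exact: measurableC.
have PV i : (P (V i) <= p%:E)%E by exact: fails_at_most_setC.
pose D (i : 'I_N) := C i `\` \big[setU/set0]_(j < N | (j < i)%N) C j.
have mD i : measurable (D i).
  apply: measurableD => //; elim/big_ind: _ => // A B; exact: measurableU.
have mUD i : measurable (U k @^-1` D i) by rewrite -[_ @^-1` _]setTI; exact: mU.
have mVD i : measurable (V i `&` U k @^-1` D i) by exact: measurableI.
have Dlt (i j : 'I_N) s : D i s -> D j s -> ~ (i < j)%N.
  by move=> [Ci _] [_ Cj] ij; apply: Cj; rewrite (bigD1 i)//=; left.
exists (\big[setU/set0]_i (V i `&` U k @^-1` D i)); split.
- exact: finite_bigsetU_measurable.
- rewrite (le_trans (le_measure_finite_bigsetU P mVD))//.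
  apply: (@le_trans _ _ (\sum_i p%:E * P (U k @^-1` D i))%E).
    apply: lee_sum => i _; rewrite iYU//; last exact: g_sigma_preimage_coord.
    by rewrite lee_wpmul2r.
  rewrite -ge0_sume_distrr//.
  rewrite -[leRHS]mule1 lee_wpmul2l ?lee_fin//.
  rewrite -measure_semi_additive_ord//; last first.
  - exact: finite_bigsetU_measurable.
  - move=> i j _ _ [w [Di Dj]]; apply/val_inj/eqP.
    rewrite eqn_leq (leqNgt i) (leqNgt j); apply/andP; split; apply/negP.
      exact: (Dlt j i (U k w)).
    exact: (Dlt i j (U k w)).
  by apply: probability_le1; exact: finite_bigsetU_measurable.
- move=> w Vw [i0 Ci0].
  have [i Ci imin] : exists2 i, C i (U k w) &
      forall j : 'I_N, (j < i)%N -> ~ C j (U k w).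
    have /asboolP i0P := Ci0.
    have [i /asboolP Ci imin] := @arg_minnP _ i0
      (fun i => `[< C i (U k w) >]) (fun i => val i) i0P.
    exists i => // j ji /asboolP/imin; rewrite leqNgt.
    by rewrite /= ji.
  exists i; split=> //; apply: contrapT => Vi; apply: Vw.
  apply/finite_bigsetUP; exists i.
  split=> //; split=> //; rewrite big_mkcond => /finite_bigsetUP[j].
  by case: ifP => // /imin.
Qed.

(** For a fixed [i] all points miss [C i] with probability at most
    [(1 - p) ^+ M]; the factor [N] is the union bound over [i]. *)
Lemma independent_hits M N (U : 'I_M -> T -> S) (C : 'I_N -> set S) (p : R) :
  (forall k, measurable_fun setT (U k)) -> mutually_independent P U ->
  (forall i, measurable (C i)) ->
  (forall i k, (p%:E <= P (U k @^-1` C i))%E) ->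
  fails_at_most P (N%:R * (1 - p) ^+ M)
    [set w | forall i, exists k, C i (U k w)].
Proof.
move=> mU iU mC pC; have -> : N%:R = #|'I_N|%:R :> R by rewrite card_ord.
apply: fails_at_most_forall => i.
have mUC k (D : set S) : measurable D -> measurable (U k @^-1` D).
  by move=> mD'; rewrite -[_ @^-1` _]setTI; exact: mU.
exists (~` (\big[setU/set0]_k (U k @^-1` C i))); split.
- by apply: measurableC; apply: finite_bigsetU_measurable => k; exact: mUC.
- have -> : ~` (\big[setU/set0]_k (U k @^-1` C i)) =
      [set w | forall k, k \in [set: 'I_M]%SET -> (~` C i) (U k w)].
    apply/seteqP; split=> w /= Cw.
      by move=> k _ Ck; apply: Cw; apply/finite_bigsetUP; exists k.
    by move=> /finite_bigsetUP[k]; apply: Cw; rewrite inE.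
  rewrite (iU [set: 'I_M]%SET (fun=> ~` C i) (fun=> measurableC (mC i))).
  rewrite [leLHS](eq_bigl xpredT); last by move=> k; exact: finset.in_setT.
  have -> : ((1 - p) ^+ M)%:E = (\prod_(k < M) (1 - p)%:E)%E.
    by rewrite prodEFin prodr_const card_ord.
  rewrite (eq_bigr (fun k => (1 - fine (P (U k @^-1` C i)))%:E)); last first.
    move=> k _; rewrite preimage_setC probability_setC; last exact: mUC.
    rewrite EFinB fineK//.
    by rewrite fin_num_measure//; exact: mUC.
  rewrite !prodEFin lee_fin; apply: ler_prod => k _.
  have := pC i k; have : P (U k @^-1` C i) \is a fin_num.
    by rewrite fin_num_measure//; exact: mUC.
  have := probability_le1 P (mUC k _ (mC i)).
  case: (P _) => //= s; rewrite !lee_fin => s1 _ ps.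
  by rewrite subr_ge0 s1 lerD2l lerN2.
- by move=> w; rewrite setCK => /finite_bigsetUP.
Qed.

End independence_lemmas.

(** * The estimated support function in a fixed direction *)

Section measurability.
Context {R : realType} {d : nat}.

Lemma continuous_measurable_vec (f : 'rV[R]_d -> R) :
  continuous f -> measurable_fun [set: Rvec R d] (f : Rvec R d -> R).
Proof.
move=> cf; apply: (measurability _ (RGenOInfty.measurableE R)) => //.
move=> _ [_ [x ->] <-]; rewrite setTI; apply: open_measurable_vec.
apply: open_comp => [y _|]; first exact: cf.
exact: interval_open.
Qed.

Context {dT : measure_display} {T : measurableType dT} (P : probability T R).
Implicit Types Z : {RV P >-> Rvec R d}.

Lemma measurable_dot (u : 'rV[R]_d) Z : measurable_fun setT (fun w => dot u (Z w)).
Proof.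
apply: (measurableT_comp (continuous_measurable_vec (@dot_continuous R d u))).
exact: measurable_funPT.
Qed.

Lemma measurable_enorm Z : measurable_fun setT (fun w => enorm (Z w : 'rV[R]_d)).
Proof.
apply: (measurableT_comp (continuous_measurable_vec (@enorm_continuous R d))).
exact: measurable_funPT.
Qed.

End measurability.

Section estimator_lemmas.
Context {R : realType} {d : nat}.
Implicit Types (u v : 'rV[R]_d) (G : set 'rV[R]_d).

Lemma h_hat_le (sigma : R) n (y : 'I_n -> 'rV[R]_d) u (c : R) : (0 < n)%N ->
  (forall j, dot u (y j) <= c + b_ sigma n) -> h_hat sigma y u <= c.
Proof.
move=> n0 yc; rewrite /h_hat lerBlDr; apply: ge_sup => [|_ [j _ <-]//].
by exists (dot u (y (Ordinal n0))), (Ordinal n0).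
Qed.

Lemma le_h_hat (sigma : R) n (y : 'I_n -> 'rV[R]_d) u (c : R) j :
  c + b_ sigma n <= dot u (y j) -> c <= h_hat sigma y u.
Proof.
move=> cy; rewrite /h_hat lerBrDr (le_trans cy)//; apply: ub_le_sup; last by exists j.
exists (\sum_i `|dot u (y i)|) => _ [i _ <-].
by rewrite (le_trans (ler_norm _))// (bigD1 i)//= lerDl sumr_ge0.
Qed.

Lemma support_lipschitz G (rmax : R) u v : compact G -> G !=set0 ->
  G `<=` eball 0 rmax -> support G u <= support G v + enorm (u - v) * rmax.
Proof.
move=> kG G0 GR; have [p Gp [-> _]] := support_attained u kG G0.
have := dot_le_support v kG Gp.
have : dot (u - v) p <= enorm (u - v) * rmax.
  rewrite (le_trans (dot_le_enorm _ _))// ler_wpM2l ?enorm_ge0//.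
  by have := GR _ Gp; rewrite /eball/= subr0.
rewrite dotBl; lra.
Qed.

End estimator_lemmas.

Section fixed_direction.
Context {R : realType} {d n : nat} {dT : measure_display}
  {T : measurableType dT} (P : probability T R).
Variables (X eps : 'I_n -> {RV P >-> Rvec R d}) (G : set 'rV[R]_d)
  (sigma rmax : R).
Hypotheses (sigma0 : 0 < sigma) (bodyG : convex_body G)
  (GR : G `<=` eball 0 rmax)
  (unifX : forall j, uniform_on_body (X j) G)
  (gauss : forall j, gaussian_vector (eps j) 0 (sigma ^+ 2)%:M).

Lemma noisy_points_upper (u : 'rV[R]_d) z : enorm u = 1 -> 0 <= z ->
  fails_at_most P (n%:R * expR (- (z ^+ 2 / (2 * sigma ^+ 2))))
    [set w | forall j,
      dot u ((X j w : 'rV[R]_d) + (eps j w : 'rV[R]_d)) <= support G u + z].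
Proof.
move=> u1 z0; have [_ kG _] := bodyG.
have cG : closed G by apply: compact_closed kG; exact: norm_hausdorff.
set e := expR _.
have -> : n%:R = #|'I_n|%:R :> R by rewrite card_ord.
apply: fails_at_most_forall => j.
have XG : fails_at_most P 0 (X j @^-1` G).
  apply: fails_at_most_null; last exact: uniform_on_body_as.
  by rewrite -[_ @^-1` _]setTI; apply: measurable_funPT => //; exact: closed_measurable_vec.
have epsz : fails_at_most P e [set w | dot u (eps j w) <= z].
  exists [set w | dot u (eps j w) \in `[z, +oo[]; split.
  - have := measurable_dot u (eps j) measurableT (measurable_itv `[z, +oo[).
    by rewrite setTI.
  - have -> := gaussian_vector_direction sigma0 (gauss j) u1 (measurable_itv `[z, +oo[).
    exact: normal_prob_tail_le.
  - by move=> w /=; rewrite in_itv/= andbT => /negP; rewrite -ltNge => /ltW.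
apply: fails_at_mostW (fails_at_mostI XG epsz); first by rewrite add0r.
by move=> w [/= GX ez]; rewrite dotDr lerD// dot_le_support.
Qed.

Hypotheses (indX : mutually_independent P X)
  (indeps : mutually_independent P eps) (indXeps : independent_families P X eps).

(** An observation exceeds the level as soon as [X j] lies in the cap of height
    [2 * rmax * l] and its noise exceeds [z] at the same time. *)
Lemma noisy_points_lower (u : 'rV[R]_d) (l q z : R) :
  enorm u = 1 -> 0 < l -> l <= 1 -> 0 <= q ->
  (q%:E <= normal_prob 0 sigma `[z, +oo[)%E ->
  fails_at_most P ((1 - l ^+ d * q) ^+ n)
    [set w | exists j, support G u - 2 * rmax * l + z <=
      dot u ((X j w : 'rV[R]_d) + (eps j w : 'rV[R]_d))].
Proof.
move=> u1 l0 l1 q0 qz.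
pose A : set (Rvec R d) := [set x | support G u - 2 * rmax * l <= dot u x].
pose B : set (Rvec R d) := [set x | dot u x \in `[z, +oo[].
have mA : measurable A.
  have -> : A = [set x | dot u x \in `[support G u - 2 * rmax * l, +oo[].
    by apply/seteqP; split=> x; rewrite /A/= in_itv/= andbT.
  have := continuous_measurable_vec (@dot_continuous R d u) measurableT
    (measurable_itv `[support G u - 2 * rmax * l, +oo[).
  by rewrite setTI.
have mB : measurable B.
  have := continuous_measurable_vec (@dot_continuous R d u) measurableT
    (measurable_itv `[z, +oo[).
  by rewrite setTI.
apply: fails_at_mostW (lexx _) _ (independent_pairs_avoid _ _ indX indeps
  indXeps mA mB (exprn_ge0 d (ltW l0)) q0 _ _).
- move=> w [j [Aj]]; rewrite /B/= in_itv/= andbT => Bj; exists j.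
  by rewrite dotDr lerD.
- by move=> j; exact: measurable_funPT.
- by move=> j; exact: measurable_funPT.
- by move=> j; exact: uniform_on_body_cap.
- move=> j; apply: (le_trans qz).
  by rewrite -(gaussian_vector_direction sigma0 (gauss j) u1 (measurable_itv `[z, +oo[)).
Qed.

End fixed_direction.

(** * Random directions *)

Section random_directions.
Context {R : realType} {d M : nat} {dT : measure_display}
  {T : measurableType dT} (P : probability T R).
Variable U : 'I_M -> {RV P >-> Rvec R d.+1}.
Hypothesis unifU : forall k, uniform_on_sphere (U k).

Lemma uniform_on_sphere_as k :
  fails_at_most P 0 [set w | enorm (U k w : 'rV[R]_d.+1) = 1].
Proof.
have [U1 _] := unifU k; apply: fails_at_most_null; last exact: U1.
exact: (measurable_funPTI (U k) (closed_measurable_vec esphere_closed)).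
Qed.

(** All balls of the same radius centered on the sphere have the same
    probability by rotation invariance, and [N] of them cover the sphere. *)
Lemma uniform_on_sphere_ball N (u : 'I_N -> 'rV[R]_d.+1) (delta : R) i k :
  (forall i, enorm (u i) = 1) ->
  (forall v, enorm v = 1 -> exists i, enorm (v - u i) <= delta) ->
  ((N%:R^-1)%:E <= P (U k @^-1` eball (u i) delta))%E.
Proof.
move=> u1 net; have [US inv] := unifU k.
have mC j : measurable (eball (u j) delta : set (Rvec R d.+1)).
  apply: (@closed_measurable_vec R d.+1); exact: eball_closed.
have mUC j : measurable (U k @^-1` eball (u j) delta).
  exact: (measurable_funPTI (U k) (mC j)).
have N0 : 0 < N%:R :> R by rewrite ltr0n; case: (N) i => // -[].
have same j : P (U k @^-1` eball (u j) delta) = P (U k @^-1` eball (u i) delta).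
  have [Q [QQ uQ]] := orthogonal_transitive (u1 j) (u1 i).
  have <- : P [set w | eball (u i) delta ((U k w : 'rV[R]_d.+1) *m Q)] =
      P (U k @^-1` eball (u i) delta) by exact: (inv Q QQ _ (mC i)).
  congr (P _); apply/seteqP; split=> w;
    by rewrite /eball/= -uQ -mulmxBl (enorm_mulmx_orthogonal _ QQ).
have : (1 <= \sum_(j < N) P (U k @^-1` eball (u j) delta))%E.
  apply: le_trans (le_measure_finite_bigsetU P mUC).
  have <- : P (U k @^-1` esphere) = 1%E by exact: US.
  apply: le_measure; rewrite ?inE.
  - exact: (measurable_funPTI (U k) (closed_measurable_vec esphere_closed)).
  - exact: finite_bigsetU_measurable.
  - by move=> w /net[j uj]; apply/finite_bigsetUP; exists j.
under eq_bigr do rewrite same.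
have : P (U k @^-1` eball (u i) delta) \is a fin_num by rewrite fin_num_measure.
case: (P _) => //= s _; rewrite sumEFin !lee_fin sumr_const card_ord -[s *+ N]mulr_natl.
by rewrite -ler_pdivrMl// mulr1.
Qed.

(** With [N] of order [delta ^- d] balls of radius [delta / 2], each of them is
    missed by all directions with probability at most [(1 - 1 / N) ^+ M]. *)
Lemma uniform_directions_net (delta : R) :
  mutually_independent P U -> 0 < delta -> delta <= 1 ->
  exists N : nat, [/\ (0 < N)%N,
    N%:R <= 2 * d.+1%:R * ((8 * d.+1%:R + 6) / delta) ^+ d &
    fails_at_most P (N%:R * expR (- (M%:R / N%:R)))
      [set w | forall v : 'rV[R]_d.+1, enorm v = 1 ->
         exists k, enorm (v - U k w) <= delta]].
Proof.
move=> indU delta0 delta1.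
have [||N [u [u1 net cardN]]] := @sphere_net R d (delta / 2); [lra|lra|].
have N0 : (0 < N)%N.
  pose v : 'rV[R]_d.+1 := delta_mx 0 ord0.
  have v0 : v != 0.
    by apply/eqP => /rowP/(_ ord0)/eqP; rewrite !mxE !eqxx oner_eq0.
  have [|[i iN] _] := net ((enorm v)^-1 *: v); last by case: (N) iN.
  by rewrite enormZ gtr0_norm ?invr_gt0 ?enorm_gt0// mulVf// gt_eqF ?enorm_gt0.
exists N; split=> //.
  rewrite (le_trans cardN)// ler_wpM2l ?mulr_ge0//.
  by rewrite (_ : _ / (delta / 2) = (8 * d.+1%:R + 6) / delta)//;
     field; rewrite gt_eqF.
have mU k : measurable_fun setT (U k) by exact: measurable_funPT.
have mC i : measurable (eball (u i) (delta / 2) : set (Rvec R d.+1)).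
  by apply: (@closed_measurable_vec R d.+1); exact: eball_closed.
have hits := independent_hits mU indU mC
  (fun i k => uniform_on_sphere_ball i k u1 net).
apply: fails_at_mostW hits.
- rewrite ler_wpM2l ?ler0n//.
  have -> : - (M%:R / N%:R) = M%:R * (- N%:R^-1) :> R by rewrite mulrN.
  rewrite expRM_natl lerXn2r ?nnegrE ?expR_ge0 ?expR_ge1Dx//.
  by rewrite subr_ge0 invf_le1 ?ltr0n// ler1n.
- move=> w hit v /net[i vi]; have [k Uk] := hit i; exists k.
  apply: le_trans (ler_enorm_distD (u i) v (U k w)) _.
  by move: Uk; rewrite /eball/= (enorm_subC (u i)); lra.
Qed.

End random_directions.

Section random_direction_estimates.
Context {R : realType} {d n M : nat} {dT : measure_display}
  {T : measurableType dT} (P : probability T R).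
Variables (X eps : 'I_n -> {RV P >-> Rvec R d.+1})
  (U : 'I_M -> {RV P >-> Rvec R d.+1}) (G : set 'rV[R]_d.+1) (sigma rmax : R).
Hypotheses (kG : compact G) (G0 : G !=set0) (GR : G `<=` eball 0 rmax).
Let Y (j : 'I_n) (w : T) : Rvec R d.+1 :=
  (X j w : 'rV[R]_d.+1) + (eps j w : 'rV[R]_d.+1).
Hypotheses (unifU : forall k, uniform_on_sphere (U k))
  (indYU : independent_families P Y U).

Lemma measurable_dot_obs (u : 'rV[R]_d.+1) j :
  measurable_fun setT (fun w => dot u (Y j w)).
Proof.
rewrite (_ : (fun _ => _) = (fun w => dot u (X j w) + dot u (eps j w))).
  by apply: measurable_funD; exact: measurable_dot.
by apply/funext => w; rewrite dotDr.
Qed.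

(** Bounds for each fixed direction extend to the random directions: the
    observations are bounded by some [K] outside an event of probability [e],
    which makes [u |-> dot u (Y j w)] Lipschitz, so that a random direction can
    be replaced by a point of a net so fine that the error is at most [rho]. *)
Lemma random_direction_estimates (lo up rho p q e : R) :
  (0 < n)%N -> 0 < rho -> 0 < e -> 0 <= p -> 0 <= q ->
  (forall u, enorm u = 1 -> fails_at_most P p
    [set w | exists j, support G u - lo + b_ sigma n <= dot u (Y j w)]) ->
  (forall u, enorm u = 1 -> fails_at_most P q
    [set w | forall j, dot u (Y j w) <= support G u + up + b_ sigma n]) ->
  fails_at_most P (M%:R * (p + q) + e) [set w | forall k,
    enorm (U k w : 'rV[R]_d.+1) = 1 /\
    support G (U k w) - (lo + rho) <= h_hat sigma (Y ^~ w) (U k w)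
      <= support G (U k w) + (up + rho)].
Proof.
move=> n0 rho0 e0 p0 q0 lower upper.
have rmax0 : 0 <= rmax.
  by case: G0 => g /GR; rewrite /eball/= subr0; apply: le_trans; exact: enorm_ge0.
pose S w := \sum_(j < n) (enorm (X j w : 'rV[R]_d.+1) + enorm (eps j w : 'rV[R]_d.+1)).
have mS : measurable_fun setT S.
  by apply: measurable_sum => j; apply: measurable_funD; exact: measurable_enorm.
have [K [K0 tight]] := fails_at_most_tight P mS e0.
have YS j w : enorm (Y j w : 'rV[R]_d.+1) <= S w.
  rewrite (le_trans (ler_enormD _ _))// /S (bigD1 j)//= lerDl sumr_ge0// => i _.
  by rewrite addr_ge0 ?enorm_ge0.
pose D := K + rmax + 1; have D0 : 0 < D by rewrite /D; lra.
(* the bound [K] and the radius [rmax] are the Lipschitz constants in [u] of the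
   observed and of the true support function *)
pose eta := Num.min 1 (rho / D).
have eta0 : 0 < eta by rewrite lt_min ltr01 divr_gt0.
have eta1 : eta <= 1 by rewrite ge_min lexx.
have etaD : eta * D <= rho by rewrite -ler_pdivlMr// ge_min lexx orbT.
have [N [u [u1 net _]]] := sphere_net d eta0 eta1.
have mC i : measurable (eball (u i) eta : set (Rvec R d.+1)).
  apply: (@closed_measurable_vec R d.+1); exact: eball_closed.
pose Wlo i := [set w | exists j, support G (u i) - lo + b_ sigma n <= dot (u i) (Y j w)].
pose Wup i := [set w | forall j, dot (u i) (Y j w) <= support G (u i) + up + b_ sigma n].
have mlow (v : 'rV[R]_d.+1) c : measurable ([set x | dot v x < c] : set (Rvec R d.+1)).
  apply: open_measurable_vec; rewrite (_ : mkset _ = [set x | - c < dot (- v) x]).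
    exact: halfspace_open.
  by apply/seteqP; split=> x; rewrite /= dotNl ltrN2.
have mup (v : 'rV[R]_d.+1) c : measurable ([set x | dot v x <= c] : set (Rvec R d.+1)).
  by apply: (@closed_measurable_vec R d.+1); exact: halfspace_closed.
have WloE i : Wlo i = ~` [set w | forall j, j \in [set: 'I_n]%SET ->
    [set x | dot (u i) x < support G (u i) - lo + b_ sigma n] (Y j w)].
  apply/seteqP; split=> w /=.
    by move=> [j lej] /(_ j (finset.in_setT j)); rewrite ltNge lej.
  move=> /existsNP[j /not_implyP[_ /negP]]; rewrite -leNgt; by exists j.
have WupE i : Wup i = [set w | forall j, j \in [set: 'I_n]%SET ->
    [set x | dot (u i) x <= support G (u i) + up + b_ sigma n] (Y j w)].
  apply/seteqP; split=> w /= Ww j; first by move=> _; exact: Ww.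
  exact: Ww (finset.in_setT j).
have gWlo i : g_sigma_preimage Y (Wlo i).
  rewrite WloE; apply: g_sigma_preimage_setC.
  exact: (g_sigma_preimage_forall (Z := Y) [set: 'I_n]%SET
    (fun=> mlow (u i) (support G (u i) - lo + b_ sigma n))).
have gWup i : g_sigma_preimage Y (Wup i).
  rewrite WupE.
  exact: (g_sigma_preimage_forall (Z := Y) [set: 'I_n]%SET
    (fun=> mup (u i) (support G (u i) + up + b_ sigma n))).
have mWlo i : measurable (Wlo i).
  rewrite (_ : Wlo i = \big[setU/set0]_j
      [set w | support G (u i) - lo + b_ sigma n <= dot (u i) (Y j w)]).
    apply: finite_bigsetU_measurable => j.
    have := measurable_dot_obs (u i) j measurableT
      (measurable_itv `[support G (u i) - lo + b_ sigma n, +oo[).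
    by rewrite setTI; congr measurable; apply/seteqP; split=> w;
      rewrite /= in_itv/= andbT.
  apply/seteqP; split=> w; last by move/finite_bigsetUP.
  by move=> Ww; apply/finite_bigsetUP.
have mWup i : measurable (Wup i).
  rewrite (_ : Wup i = ~` \big[setU/set0]_j
      [set w | support G (u i) + up + b_ sigma n < dot (u i) (Y j w)]).
    apply: measurableC; apply: finite_bigsetU_measurable => j.
    have := measurable_dot_obs (u i) j measurableT
      (measurable_itv `]support G (u i) + up + b_ sigma n, +oo[).
    by rewrite setTI; congr measurable; apply/seteqP; split=> w;
      rewrite /= in_itv/= andbT.
  apply/seteqP; split=> w /=.
    by move=> Ww /finite_bigsetUP[j] /=; rewrite ltNge Ww.
  by move=> Ww j; rewrite leNgt; apply/negP => lt_j; apply: Ww;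
     apply/finite_bigsetUP; exists j.
have mU k : measurable_fun setT (U k) by exact: measurable_funPT.
have cells k := fails_at_mostI
  (independent_cells (mU k) indYU mC gWlo mWlo (fun i => lower _ (u1 i)) p0)
  (fails_at_mostI (uniform_on_sphere_as unifU k)
    (independent_cells (mU k) indYU mC gWup mWup (fun i => upper _ (u1 i)) q0)).
have good := fails_at_mostI (fails_at_most_forall cells) tight.
apply: fails_at_mostW good; first by rewrite card_ord add0r.
move=> w [/= cell SK] k; have [clo [Uk1 cup]] := cell k; split=> //.
have covered : exists i, eball (u i) eta (U k w) by exact: net.
have YK j : enorm (Y j w : 'rV[R]_d.+1) <= K by exact: le_trans SK.
have close (v v' : 'rV[R]_d.+1) : enorm (v - v') <= eta ->
    (forall j, dot v (Y j w) <= dot v' (Y j w) + eta * K) /\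
    support G v <= support G v' + eta * rmax.
  move=> vv'; split=> [j|]; last first.
    by rewrite (le_trans (support_lipschitz _ v' kG G0 GR))// lerD2l ler_wpM2r.
  have : dot (v - v') (Y j w) <= eta * K.
    by rewrite (le_trans (dot_le_enorm _ _))// ler_pM ?enorm_ge0.
  by rewrite dotBl; lra.
have etaE : eta * K + eta * rmax <= rho.
  by apply: le_trans etaD; rewrite -mulrDr ler_wpM2l ?ltW// /D; lra.
apply/andP; split.
  have [i [Ui [j leY]]] := clo covered.
  have [_ sU] := close (U k w) (u i) Ui.
  rewrite /eball/= enorm_subC in Ui; have [dY _] := close (u i) (U k w) Ui.
  apply: (@le_h_hat _ _ _ _ _ _ _ j).
  by have := dY j; move: leY sU etaE; lra.
have [i [Ui leY]] := cup covered.
have [dY _] := close (U k w) (u i) Ui.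
rewrite /eball/= enorm_subC in Ui; have [_ sU] := close (u i) (U k w) Ui.
apply: h_hat_le => // j.
by have := dY j; have := leY j; move: sU etaE; lra.
Qed.

End random_direction_estimates.

(** * Numerical estimates *)

Section numerical_estimates.
Context {R : realType}.

Lemma b_gt0 (sigma : R) n : 0 < sigma -> (3 < n)%N -> 0 < b_ sigma n.
Proof.
move=> s0 n3; rewrite sqrtr_gt0 !mulr_gt0 ?exprn_gt0//.
by rewrite ln_gt0// ltr1n; exact: leq_trans n3.
Qed.

Lemma expR_b_sqr (sigma : R) n : 0 < sigma -> (3 < n)%N ->
  expR (- (b_ sigma n ^+ 2 / (2 * sigma ^+ 2))) = n%:R^-1.
Proof.
move=> s0 n3; have n0 : 0 < n%:R :> R by rewrite ltr0n; exact: leq_trans n3.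
have n1 : 0 < ln n%:R :> R by rewrite ln_gt0// ltr1n; exact: leq_trans n3.
rewrite sqr_sqrtr; last by rewrite !mulr_ge0 ?exprn_ge0// ltW.
rewrite mulrC mulrA mulVf ?mul1r; last by rewrite gt_eqF// mulr_gt0 ?exprn_gt0.
by rewrite expRN lnK.
Qed.

(** If [M * ln M ^+ d / b ^+ d] exceeds [expR d.+1], which the choice of [c]
    forces here because [6 * b >= 6], then so does [(M / b) ^+ d * M], as
    [ln M <= M]; both conclusions are read off
    [M ^+ d.+1 > expR d.+1 * b ^+ d]. *)
Lemma many_directions (d M : nat) (b c : R) :
  (0 < d)%N -> (0 < M)%N -> 1 <= b -> c <= ln 6 * expR (- d.+1%:R) ->
  0 < c ->
  (6 * b) ^+ d.+1 * expR (- (c * M%:R * ln M%:R ^+ d * b ^- d)) < 1 ->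
  1 <= ln M%:R :> R /\ b <= M%:R ^+ d.+1.
Proof.
move=> d0 M0 b1 cle c0.
have M1 : 1 <= M%:R :> R by rewrite ler1n.
have lnM0 : 0 <= ln M%:R :> R by rewrite ln_ge0.
have b0 : 0 < b by lra.
have bd : b <= b ^+ d by rewrite ler_eXnr.
pose Q := M%:R * ln M%:R ^+ d * b ^- d.
have -> : c * M%:R * ln M%:R ^+ d * b ^- d = c * Q by rewrite /Q !mulrA.
rewrite expRN ltr_pdivrMr ?expR_gt0// mul1r => ltQ.
have l6 : 0 < ln 6 :> R by rewrite ln_gt0// ltr1n.
have lt6 : 6 < expR (c * Q).
  apply: le_lt_trans ltQ; apply: (@le_trans _ _ (6 * b)); first lra.
  by rewrite ler_eXnr//; lra.
have cQ : ln 6 < c * Q by rewrite -ltr_expR lnK ?posrE.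
have QD : expR d.+1%:R < Q.
  have Q0 : 0 < Q by rewrite -(pmulr_rgt0 _ c0); exact: lt_trans cQ.
  have : ln 6 < ln 6 * expR (- d.+1%:R) * Q.
    by rewrite (lt_le_trans cQ)// ler_wpM2r// ltW.
  rewrite -mulrA -{1}[ln 6]mulr1 ltr_pM2l// expRN.
  by rewrite mulrC ltr_pdivlMr ?expR_gt0// mul1r.
have MD : expR d.+1%:R * b ^+ d < M%:R ^+ d.+1.
  have bd0 : 0 < b ^+ d by rewrite exprn_gt0.
  move: QD; rewrite /Q ltr_pdivlMr// => /lt_le_trans; apply.
  rewrite exprS ler_wpM2l ?ler0n// lerXn2r ?nnegrE ?ler0n//.
  by rewrite ltW// ln_sublinear// ltr0n.
have e1 : 1 <= expR d.+1%:R :> R.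
  by have := expR_ge1Dx (d.+1%:R : R); have := ler0n R d.+1; lra.
split; last by nra.
have : expR d.+1%:R < M%:R ^+ d.+1 :> R.
  by apply: le_lt_trans MD; rewrite ler_peMr ?expR_ge0//; lra.
rewrite -[X in _ < X ^+ _]lnK ?posrE ?ltr0n// -expRM_natl ltr_expR.
by rewrite -[X in X < _]mulr1 ltr_pM2l ?ltr0n// => /ltW.
Qed.

(** The polynomial loss [b ^- D.+1] is compensated by the part
    [D * D.+2 * ln M] of the exponent, whose exponential is at least
    [b ^+ D.+2]; the remaining factor [b] absorbs the constant [a]. *)
Lemma exceedance_small (D M : nat) (a b y x : R) : (0 < M)%N -> 1 <= b ->
  0 < a -> 1 <= a * b -> b <= M%:R ^+ D -> 0 < x -> y = x + ln M%:R ->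
  y <= b ^- D.+1 * a * expR ((1 + (D * D.+2)%:R) * y).
Proof.
move=> M0 b1 a0 ab bM x0 ->.
have b0 : 0 < b by lra.
have M0' : 0 < M%:R :> R by rewrite ltr0n.
have lnM0 : 0 <= ln M%:R :> R by rewrite ln_ge0 ?ler1n.
set y' := x + _; have y0 : 0 <= y' by rewrite /y'; lra.
have bD : b ^+ D.+2 <= expR ((D * D.+2)%:R * y').
  apply: (@le_trans _ _ (expR ((D * D.+2)%:R * ln M%:R))); last first.
    by rewrite ler_expR ler_wpM2l ?ler0n// /y'; lra.
  rewrite expRM_natl lnK ?posrE// exprM.
  by rewrite lerXn2r// nnegrE ?exprn_ge0 ?ler0n// ltW.
have ey : y' <= expR y' by have := expR_ge1Dx y'; lra.
rewrite mulrDl mul1r expRD.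
apply: (@le_trans _ _ (b ^- D.+1 * a * (expR y' * b ^+ D.+2))); last first.
  by rewrite ler_wpM2l ?ler_wpM2l ?expR_ge0// mulr_ge0 ?invr_ge0 ?exprn_ge0 ?ltW.
have -> : b ^- D.+1 * a * (expR y' * b ^+ D.+2) = a * b * expR y'.
  by rewrite [b ^+ D.+2]exprS; field; rewrite expf_neq0 ?gt_eqF.
by rewrite (le_trans ey)// ler_peMl ?expR_ge0.
Qed.

(** Half of the exponent already gives [expR (beta * b) >= y]; the other half is
    compared with a power of [b] through
    [expR z = expR (z / D.+2) ^+ D.+2 >= (z / D.+2) ^+ D.+2]. *)
Lemma exceedance_large (D : nat) (a b y beta : R) : 0 < beta -> 1 <= b ->
  0 < a -> 1 <= a * (beta / D.+2%:R) ^+ D.+2 * b -> y <= beta * b ->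
  y <= b ^- D.+1 * a * expR (2 * (beta * b)).
Proof.
move=> beta0 b1 a0 ab yb; have b0 : 0 < b by lra.
have bb0 : 0 <= beta * b by rewrite mulr_ge0 ?ltW.
have e1 : y <= expR (beta * b) by have := expR_ge1Dx (beta * b); lra.
have e2 : (beta / D.+2%:R * b) ^+ D.+2 <= expR (beta * b).
  have -> : beta * b = D.+2%:R * (beta / D.+2%:R * b).
    by rewrite mulrA [_ * (beta / _)]mulrC divfK// pnatr_eq0.
  rewrite expRM_natl; set z := _ / _ * _.
  have z0 : 0 <= z by rewrite mulr_ge0 ?divr_ge0 ?ler0n ?ltW.
  rewrite lerXn2r ?nnegrE ?expR_ge0//.
  by have := expR_ge1Dx z; lra.
rewrite mulr_natl mulr2n expRD.
have ba0 : 0 <= b ^- D.+1 * a by rewrite mulr_ge0 ?invr_ge0 ?exprn_ge0 ?ltW.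
suff : 1 <= b ^- D.+1 * a * expR (beta * b).
  rewrite mulrA => one; rewrite (le_trans e1)//.
  by rewrite ler_peMl ?expR_ge0.
apply: (le_trans ab).
have -> : a * (beta / D.+2%:R) ^+ D.+2 * b =
    b ^- D.+1 * a * (beta / D.+2%:R * b) ^+ D.+2.
  rewrite [(_ * b) ^+ _]exprMn [b ^+ D.+2]exprS; set c := (beta / _) ^+ _.
  by field; rewrite expf_neq0 ?gt_eqF.
by rewrite ler_wpM2l.
Qed.

End numerical_estimates.

(** * Deviations at the normalisation of the estimator *)

Section deviation_rates.
Context {R : realType} {d n : nat} {dT : measure_display}
  {T : measurableType dT} (P : probability T R).
Variables (X eps : 'I_n -> {RV P >-> Rvec R d}) (G : set 'rV[R]_d)
  (sigma rmax : R).
Hypotheses (sigma0 : 0 < sigma) (n3 : (3 < n)%N) (bodyG : convex_body G)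
  (rmax0 : 0 <= rmax) (GR : G `<=` eball 0 rmax)
  (unifX : forall j, uniform_on_body (X j) G)
  (gauss : forall j, gaussian_vector (eps j) 0 (sigma ^+ 2)%:M).
Let b := b_ sigma n.
Let b0 : 0 < b. Proof. exact: b_gt0. Qed.
Let s2 : 0 < sigma ^+ 2. Proof. exact: exprn_gt0. Qed.
Let n0 : 0 < n%:R :> R. Proof. by rewrite ltr0n; exact: leq_trans n3. Qed.

(** The tail at [b + s] is at most the tail at [b], which is [1 / n], times
    [expR (- b * s / sigma ^+ 2)]. *)
Lemma upper_deviation (u : 'rV[R]_d) y : enorm u = 1 -> 0 <= y ->
  fails_at_most P (expR (- y)) [set w | forall j,
    dot u ((X j w : 'rV[R]_d) + (eps j w : 'rV[R]_d)) <=
    support G u + sigma ^+ 2 * (y / b) + b].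
Proof.
move=> u1 y0; set s := sigma ^+ 2 * (y / b).
have sge0 : 0 <= s by rewrite mulr_ge0 ?divr_ge0// ltW.
have bs : b * s = sigma ^+ 2 * y by rewrite /s; field; rewrite gt_eqF.
have := noisy_points_upper sigma0 bodyG unifX gauss u1 (addr_ge0 sge0 (ltW b0)).
apply: fails_at_mostW => [|w Yw j]; last by rewrite -addrA.
have -> : - ((s + b) ^+ 2 / (2 * sigma ^+ 2)) =
    - (b ^+ 2 / (2 * sigma ^+ 2)) + (- y - s ^+ 2 / (2 * sigma ^+ 2)).
  rewrite sqrrD [s * b]mulrC bs.
  by field; rewrite gt_eqF.
rewrite expRD expR_b_sqr// mulrA mulfV ?gt_eqF// mul1r ler_expR gerBl.
by rewrite divr_ge0 ?sqr_ge0// mulr_ge0// ltW.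
Qed.

Hypotheses (indX : mutually_independent P X)
  (indeps : mutually_independent P eps) (indXeps : independent_families P X eps).

(** An upper bound for [v ^+ 2 - (b ^+ 2 - 2 * (b * t))], for the noise levels
    [v] within [(2 * rmax + 1) / b] above [b - t] and for [t <= tmax]. *)
Definition level_slack (tmax : R) : R :=
  2 * (2 * rmax + 1) + (tmax + 2 * rmax + 1) ^+ 2.

(** The cap of height [2 * rmax / b] has probability at least [b ^- d]; the
    noise lies in an interval of length [1 / b] just above
    [b - t + 2 * rmax / b], where the density is of order
    [expR (b * t / sigma ^+ 2) / n].  The product of the two, times [n], bounds
    the expected number of observations above the level. *)
Lemma lower_deviation (u : 'rV[R]_d) t tmax y : enorm u = 1 -> 1 <= b ->
  0 <= t -> t <= tmax ->
  y <= b ^- d.+1 *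
    (normal_peak sigma * expR (- (level_slack tmax / (2 * sigma ^+ 2)))) *
    expR (b * t / sigma ^+ 2) ->
  fails_at_most P (expR (- y)) [set w | exists j, support G u - t + b <=
    dot u ((X j w : 'rV[R]_d) + (eps j w : 'rV[R]_d))].
Proof.
move=> u1 b1 t0 ttmax yle; set c := level_slack tmax in yle.
pose l := b^-1; have l0 : 0 < l by rewrite invr_gt0.
have l1 : l <= 1 by rewrite invf_le1.
have bl : b * l = 1 by rewrite mulfV// gt_eqF.
pose z := b - t + 2 * rmax * l.
pose q := l * (normal_peak sigma *
  expR (- ((b ^+ 2 - 2 * (b * t) + c) / (2 * sigma ^+ 2)))).
have q0 : 0 <= q.
  by rewrite mulr_ge0 ?(ltW l0)// mulr_ge0 ?normal_peak_ge0 ?expR_ge0.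
have qz : (q%:E <= normal_prob 0 sigma `[z, +oo[)%E.
  apply: normal_prob_tail_ge => // v zv vz; pose k := b - v.
  have kt : k <= t.
    have : 0 <= 2 * rmax * l by rewrite !mulr_ge0// ltW.
    by rewrite /k; move: zv; rewrite /z; lra.
  have kl : t - (2 * rmax + 1) * l <= k by rewrite /k; move: vz; rewrite /z; lra.
  have bk : b * t - (2 * rmax + 1) <= b * k.
    have : b * (t - (2 * rmax + 1) * l) <= b * k by rewrite ler_wpM2l// ltW.
    by rewrite mulrBr mulrCA bl mulr1.
  have rl : (2 * rmax + 1) * l <= 2 * rmax + 1.
    by rewrite ler_piMr// addr_ge0// mulr_ge0.
  have k2 : k ^+ 2 <= (tmax + 2 * rmax + 1) ^+ 2.
    have T0 : 0 <= tmax + 2 * rmax + 1.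
      by have := le_trans t0 ttmax; lra.
    rewrite -[k ^+ 2]real_normK ?num_real// lerXn2r ?nnegrE//.
    by rewrite ler_norml; apply/andP; split; lra.
  have -> : v = b - k by rewrite /k; lra.
  rewrite sqrrB /c /level_slack; lra.
have := noisy_points_lower sigma0 bodyG GR unifX gauss indX indeps indXeps
  u1 l0 l1 q0 qz.
apply: fails_at_mostW => [|w [j Yw]]; last first.
  by exists j; move: Yw; rewrite /z; lra.
have q1 : q <= 1 by rewrite -lee_fin (le_trans qz)// probability_le1.
have ld1 : l ^+ d <= 1 by rewrite exprn_ile1// ltW.
have ld0 : 0 <= l ^+ d by rewrite exprn_ge0// ltW.
have -> : - y = n%:R * (- (y / n%:R)) by field; rewrite gt_eqF.
rewrite expRM_natl lerXn2r ?nnegrE ?expR_ge0//.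
  by rewrite subr_ge0 mulr_ile1.
apply: le_trans (expR_ge1Dx _); rewrite lerD2l lerN2 ler_pdivrMr//.
apply: (le_trans yle); rewrite le_eqVlt; apply/orP; left; apply/eqP.
rewrite /q.
have -> : - ((b ^+ 2 - 2 * (b * t) + c) / (2 * sigma ^+ 2)) =
    - (b ^+ 2 / (2 * sigma ^+ 2)) + (- (c / (2 * sigma ^+ 2)) +
    b * t / sigma ^+ 2) by field; rewrite gt_eqF.
rewrite !expRD expR_b_sqr// /l exprVn [b ^+ d.+1]exprS.
set e1 := expR _; set e2 := expR _.
by field; rewrite !gt_eqF// exprn_gt0.
Qed.

End deviation_rates.

(** * The Hausdorff risk bound *)

Theorem theorem3 (R : realType) (d : nat) (sigma r rmax : R) :
  (2 <= d)%N -> 0 < sigma -> 0 < r -> r <= rmax ->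
  exists c0 c1 c2 c3 : R, [/\ 0 < c0, 0 < c1, 0 < c2 & 0 < c3] /\
  forall n M : nat, (3 < n)%N -> (0 < M)%N ->
  let b := b_ sigma n in
  ln M%:R / b <= Num.min (r / (4 * sigma ^+ 2)) (1 / 2) ->
  forall G : set 'rV[R]_d, convex_body G ->
  (exists a : 'rV[R]_d, eball a r `<=` G) -> G `<=` eball 0 rmax ->
  forall x : R, 0 < x -> x <= r * b / (4 * sigma ^+ 2) - ln M%:R ->
  forall (dT : measure_display) (T : measurableType dT) (P : probability T R)
    (X eps : 'I_n -> {RV P >-> Rvec R d}) (U : 'I_M -> {RV P >-> Rvec R d}),
  let Y (j : 'I_n) (w : T) : Rvec R d :=
    (X j w : 'rV[R]_d) + (eps j w : 'rV[R]_d) in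
  (forall j, uniform_on_body (X j) G) -> mutually_independent P X ->
  (forall j, gaussian_vector (eps j) 0 (sigma ^+ 2)%:M) ->
  mutually_independent P eps ->
  independent_families P X eps ->
  (forall k, uniform_on_sphere (U k)) -> mutually_independent P U ->
  independent_families P Y U ->
  exists E : set T,
  [/\ measurable E,
      E `<=` [set w | (hausdorff_dist
                         (G_hat sigma (fun j => Y j w) (fun k => U k w)) G
                       <= (c0 * ((x + ln M%:R) / b))%:E)%E]
    & ((1 - c1 * expR (- x) - M%:R * expR (- (c2 * n%:R))
        - (6 * b) ^+ d *
          expR (- (c3 * M%:R * ln M%:R ^+ d.-1 * b ^- d.-1)))%:E <= P E)%E].
Proof.
case: d => [//|d] d1 sigma0 r0 rR.
have R0 : 0 < rmax by exact: lt_le_trans rR.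
have s2 : 0 < sigma ^+ 2 by rewrite exprn_gt0.
pose D := d.+1.
pose beta := r / (4 * sigma ^+ 2).
have beta0 : 0 < beta by rewrite divr_gt0// mulr_gt0.
pose C : R := 2 * d.+1%:R * (8 * d.+1%:R + 6) ^+ d.
have C0 : 0 < C by rewrite !mulr_gt0 ?exprn_gt0 ?addr_gt0 ?mulr_gt0 ?ltr0n.
pose a := normal_peak sigma *
  expR (- (level_slack rmax (r / 2) / (2 * sigma ^+ 2))).
have a0 : 0 < a by rewrite mulr_gt0 ?expR_gt0// normal_peak_gt0// gt_eqF.
pose a' := a * (beta / D.+2%:R) ^+ D.+2.
have a'0 : 0 < a' by rewrite mulr_gt0// exprn_gt0// divr_gt0.
(* thresholds for [b] under which the constants [a], [a'], [C] are absorbed *)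
pose bmin := 1 + a^-1 + a'^-1 + C.
(* one [expR (- x)] each for the upper bounds, the lower bounds and the
   boundedness of the data; the rest makes the claim void for [b <= bmin],
   where [x <= beta * bmin] *)
pose c1 := 3 + expR (beta * bmin).
(* [C^-1] is the rate of the covering bound, [l6] serves [many_directions] *)
pose l6 := ln 6 * expR (- d.+1%:R) : R.
have l60 : 0 < l6 by rewrite mulr_gt0 ?expR_gt0// ln_gt0// ltr1n.
pose c3 := Num.min C^-1 l6.
have c30 : 0 < c3 by rewrite lt_min invr_gt0 C0 l60.
(* lower deviations are of size [kappa * (x + ln M) / b], capped at [r / 2] *)
pose kappa := sigma ^+ 2 * (1 + (D * D.+2)%:R).
have kappa0 : 0 < kappa by rewrite mulr_gt0// addr_gt0// ltr0n.
pose c0 := 2 * rmax * (kappa + sigma ^+ 2) / r + 4 * sigma ^+ 2 + 4 * rmax.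
have c00 : 0 < c0.
  rewrite !addr_gt0 ?mulr_gt0 ?invr_gt0 ?addr_gt0//.
exists c0, c1, 1, c3; split; first by split=> //; rewrite addr_gt0 ?expR_gt0.
move=> n M n3 M0 b lnMb G bodyG [ctr ballG] GR x x0 xle dT T P X eps U Y.
move=> unifX indX gauss indeps indXeps unifU indU indYU.
have b0 : 0 < b by exact: b_gt0.
have lnM0 : 0 <= ln M%:R :> R by rewrite ln_ge0// ler1n.
set lastterm := (6 * b) ^+ d.+1 * _.
have last0 : 0 <= lastterm by rewrite mulr_ge0 ?expR_ge0// exprn_ge0// mulr_ge0// ltW.
have Mn0 : 0 <= M%:R * expR (- (1 * n%:R)) :> R by rewrite mulr_ge0 ?expR_ge0.
pose y := x + ln M%:R.
have y0 : 0 < y by rewrite /y; lra.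
have yle : y <= beta * b by rewrite /y /beta mulrAC; lra.
(* both excluded regimes make the claimed lower bound nonpositive *)
have trivial_case : 1 <= c1 * expR (- x) \/ 1 <= lastterm ->
    exists E : set T, [/\ measurable E,
      E `<=` [set w | (hausdorff_dist
        (G_hat sigma (fun j => Y j w) (fun k => U k w)) G <=
        (c0 * ((x + ln M%:R) / b))%:E)%E]
      & ((1 - c1 * expR (- x) - M%:R * expR (- (1 * n%:R)) - lastterm)%:E
         <= P E)%E].
  move=> H; exists set0; split=> //; rewrite measure0 lee_fin.
  have := expR_ge0 (- x); have : 0 <= c1 * expR (- x).
    by rewrite mulr_ge0 ?expR_ge0// addr_ge0 ?expR_ge0.
  by case: H; lra.
have [bb|bb] := leP b bmin.
  apply: trivial_case; left; rewrite -ler_pdivrMr ?expR_gt0// expRN invrK mul1r.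
  have : expR x <= expR (beta * bmin).
    rewrite ler_expR; apply: (@le_trans _ _ (beta * b)); first by move: yle; rewrite /y; lra.
    by rewrite ler_pM2l.
  by rewrite /c1; lra.
have [lt1|ge1] := ltP lastterm 1; last by apply: trivial_case; right.
clear trivial_case.
have [ia ia' iC] : [/\ 0 < a^-1, 0 < a'^-1 & 0 < C] by rewrite !invr_gt0.
have b1 : 1 <= b by move: bb; rewrite /bmin; lra.
have ab : 1 <= a * b.
  by rewrite -ler_pdivrMl// mulr1; move: bb; rewrite /bmin; lra.
have a'b : 1 <= a' * b.
  by rewrite -ler_pdivrMl// mulr1; move: bb; rewrite /bmin; lra.
have Cb : C <= b by move: bb; rewrite /bmin; lra.
have [lnM1 bM] : 1 <= ln M%:R :> R /\ b <= M%:R ^+ d.+1.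
  by apply: many_directions b1 _ c30 lt1 => //; rewrite ge_min lexx orbT.
pose delta := ln M%:R / b.
have delta0 : 0 < delta by rewrite divr_gt0//; lra.
have delta1 : delta <= 1.
  by move: lnMb; rewrite le_min => /andP[_]; rewrite -/delta; lra.
pose tau := y / b.
have tau0 : 0 < tau by rewrite divr_gt0.
have taub : tau * b = y by rewrite divfK// gt_eqF.
have taubeta : tau <= beta by rewrite ler_pdivrMr.
have s2tau : sigma ^+ 2 * tau <= r / 4.
  have : sigma ^+ 2 * tau <= sigma ^+ 2 * beta by rewrite ler_pM2l.
  by rewrite (_ : sigma ^+ 2 * beta = r / 4)// /beta; field; rewrite gt_eqF.
have deltatau : delta <= tau by rewrite ler_pM2r ?invr_gt0// /y; lra.
pose t := Num.min (kappa * tau) (r / 2).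
have t0 : 0 <= t by rewrite le_min mulr_ge0 ?divr_ge0 ?ltW.
have tr2 : t <= r / 2 by rewrite ge_min lexx orbT.
have trate : y <= b ^- d.+2 * a * expR (b * t / sigma ^+ 2).
  rewrite /t; have [_|_] := leP (kappa * tau) (r / 2).
    have -> : b * (kappa * tau) / sigma ^+ 2 = (1 + (D * D.+2)%:R) * y.
      by rewrite -taub /kappa; field; rewrite gt_eqF.
    exact: (exceedance_small M0 b1 a0 ab bM x0 (erefl y)).
  have -> : b * (r / 2) / sigma ^+ 2 = 2 * (beta * b).
    by rewrite /beta; field; rewrite gt_eqF.
  exact: (exceedance_large beta0 b1 a0 a'b yle).
have [_ kG _] := bodyG.
have G0 : G !=set0 by exists ctr; apply: ballG; rewrite /eball/= subrr enorm0 ltW.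
have estimates : fails_at_most P (3 * expR (- x)) [set w | forall k,
    enorm (U k w : 'rV[R]_d.+1) = 1 /\
    support G (U k w) - (t + sigma ^+ 2 * tau) <= h_hat sigma (Y ^~ w) (U k w)
      <= support G (U k w) + (sigma ^+ 2 * tau + sigma ^+ 2 * tau)].
  have low u (u1 : enorm u = 1) := lower_deviation sigma0 n3 bodyG (ltW R0) GR
    unifX gauss indX indeps indXeps u1 b1 t0 tr2 trate.
  have up u (u1 : enorm u = 1) := upper_deviation sigma0 n3 bodyG unifX gauss
    u1 (ltW y0).
  have := random_direction_estimates kG G0 GR unifU indYU (leq_trans _ n3)
    (mulr_gt0 s2 tau0) (expR_gt0 (- x)) (expR_ge0 (- y)) (expR_ge0 (- y)) low up.
  move=> /(_ isT); apply: fails_at_mostW => //.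
  have -> : expR (- y) = M%:R^-1 * expR (- x).
    by rewrite /y opprD addrC expRD [expR (- ln _)]expRN lnK ?posrE ?ltr0n.
  rewrite le_eqVlt; apply/orP; left; apply/eqP.
  by field; rewrite pnatr_eq0 -lt0n.
have [N [N0 cardN net]] := uniform_directions_net unifU indU delta0 delta1.
have netlast : N%:R * expR (- (M%:R / N%:R)) <= lastterm.
  have Nr0 : 0 < N%:R :> R by rewrite ltr0n.
  have bd0 : 0 < b ^+ d by rewrite exprn_gt0.
  have ln_d : 1 <= ln M%:R ^+ d :> R by rewrite exprn_ege1.
  have NC : N%:R <= C * b ^+ d / ln M%:R ^+ d.
    apply: (le_trans cardN); rewrite le_eqVlt; apply/orP; left; apply/eqP.
    rewrite /C /delta; set e := 8 * _ + 6; set L := ln _ in ln_d *.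
    rewrite invf_div mulrA [(e * b / L) ^+ d]exprMn [(e * b) ^+ d]exprMn exprVn.
    by rewrite !mulrA.
  have NCb : N%:R <= C * b ^+ d.
    apply: (le_trans NC); rewrite ler_pdivrMr; last by lra.
    by rewrite ler_peMr// mulr_ge0 ?ltW.
  apply: ler_pM => //.
  - apply: (le_trans NCb); rewrite exprMn.
    have : 1 <= (6 : R) ^+ d.+1 by rewrite exprn_ege1//; lra.
    have : C * b ^+ d <= b ^+ d.+1 by rewrite exprS ler_pM2r.
    by move=> h1 h2; rewrite (le_trans h1)// ler_peMl// exprn_ge0// ltW.
  - rewrite ler_expR lerN2.
    pose Q := M%:R * ln M%:R ^+ d * b ^- d.
    have Q0 : 0 <= Q.
      by rewrite divr_ge0 ?(ltW bd0)// mulr_ge0 ?ler0n// exprn_ge0.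
    have -> : c3 * M%:R * ln M%:R ^+ d * b ^- d = c3 * Q by rewrite /Q !mulrA.
    apply: (@le_trans _ _ (C^-1 * Q)); first by rewrite ler_wpM2r// ge_min lexx.
    rewrite ler_pdivlMr// mulrC.
    apply: (le_trans (ler_wpM2r _ NC)); first by rewrite mulr_ge0// invr_ge0 ltW.
    rewrite le_eqVlt; apply/orP; left; apply/eqP; rewrite /Q; field.
    by rewrite !gt_eqF//; lra.
have [B [mB PB good]] := fails_at_mostI estimates net.
exists (~` B); split; first exact: measurableC.
- move=> w /good [/= est cover].
  have Uk k : enorm (U k w : 'rV[R]_d.+1) = 1 by case: (est k).
  have hk k : support G (U k w) - (t + sigma ^+ 2 * tau) <=
      h_hat sigma (Y ^~ w) (U k w) <=
      support G (U k w) + (sigma ^+ 2 * tau + sigma ^+ 2 * tau).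
    by case: (est k).
  apply: (hausdorff_polytope_le bodyG r0 ballG GR Uk hk _ _ delta1 cover).
  + by rewrite addr_ge0// mulr_ge0 ?ltW.
  + by lra.
  + by rewrite mulr_gt0.
  + rewrite -/y -/tau.
    have : 2 * rmax * (t + sigma ^+ 2 * tau) / r <=
        2 * rmax * (kappa + sigma ^+ 2) / r * tau.
      rewrite [leRHS]mulrAC ler_pM2r ?invr_gt0// -[leRHS]mulrA ler_pM2l ?mulr_gt0//.
      by rewrite mulrDl lerD2r ge_min lexx.
    have : 0 <= (4 * sigma ^+ 2 + 4 * rmax) * tau.
      by rewrite ltW// mulr_gt0// addr_gt0// mulr_gt0.
    by rewrite /c0; lra.
  + rewrite -/y -/tau.
    have : 0 <= 2 * rmax * (kappa + sigma ^+ 2) / r * tau.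
      by rewrite ltW// !mulr_gt0 ?invr_gt0// addr_gt0.
    have : rmax * delta <= rmax * tau by rewrite ler_pM2l.
    by rewrite /c0; lra.
- rewrite probability_setC//.
  have : P B \is a fin_num by rewrite fin_num_measure.
  move: PB; case: (P B) => //= p; rewrite lee_fin => pB _; rewrite lee_fin.
  have : 3 * expR (- x) <= c1 * expR (- x).
    by rewrite ler_wpM2r ?expR_ge0// /c1 lerDl expR_ge0.
  by lra.
Qed.
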